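(* Let $N \in \mathbb{N}$, let $F \subseteq \ell_1^N$ be a non-empty finite skew subset, and let $m$ be the number of elements of $F$. Then, for every real $r$ with $0 < r < \frac{\mathrm{skew}(F)}{2}$, the union of cubes $\overline{C}_F(r)$ has a unique weight measure. Denoting this measure by $\omega_{\overline{C}_F(r)}$, it is given by \[\omega_{\overline{C}_F(r)} = \Big(\tfrac{1}{2^N} \sum_{D = 0}^{N} \lambda^D_{\overline{C}_F(r)^{(D)}}\Big) - \sum_{\substack{p \in F \\ s \in \{-1,1\}^N}} \alpha_{p,s}(r)\, \delta_{p + r s},\] where the $2^N m$ coefficients $\alpha_{p,s}(r) \in \mathbb{R}$ are uniquely determined by the system of $2^N m$ linear equations \[\sum_{\substack{p \in F \\ s \in \{-1,1\}^N}} \alpha_{p,s}(r)\, e^{-d_1(p + r s,\, q + r t)} = \sum_{p \in F \setminus \{q\}} e^{-d_1(\overline{C}_p(r),\, q + r t)}, \qquad q \in F,\ t \in \{-1,1\}^N.\] Moreover, \[\mathsf{mag}\big(\overline{C}_F(r)\big) = m\,(1+r)^N - \sum_{\substack{p \in F \\ s \in \{-1,1\}^N}} \alpha_{p,s}(r).\]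
   Context: $\mathbb{N}$ includes $0$. $\ell_1^N$ is $\mathbb{R}^N$ with the metric $d_1(x,y) = \sum_{k=1}^N |x_k - y_k|$, and for a set $A$, $d_1(A,x) = \inf_{a \in A} d_1(a,x)$. All subsets below carry the metric $d_1$. Skewness: for $S \subseteq \mathbb{R}^N$, $\mathrm{skew}(S) := \inf\{|a_k - b_k| : a,b \in S,\ a \neq b,\ 1 \leq k \leq N\}$, with $\mathrm{skew}(S) := \infty$ if $S$ is empty or a singleton (then the condition $r < \mathrm{skew}(S)/2$ is vacuous). $S$ is skew when $\mathrm{skew}(S) > 0$. Cubes: for $p \in \mathbb{R}^N$ and $r \ge 0$, $\overline{C}_p(r) := \prod_{k=1}^N [p_k - r, p_k + r]$, and $\overline{C}_F(r) := \bigcup_{p \in F} \overline{C}_p(r)$. For $0 < r < \mathrm{skew}(F)/2$ this is a disjoint union of cubes; $\overline{C}_F(r)^{(D)}$ denotes the union of all $D$-dimensional faces of these cubes, and $\lambda^D_S$ denotes the $D$-dimensional Lebesgue measure on $S$ ($D$-dimensional volume along the $D$-dimensional faces; for $D=0$, counting measure). $\delta_x$ is the Dirac measure at $x$. Weight measure: for a compact positive definite metric space $(K,d)$ (positive definite: for every finite subset the matrix $(e^{-d(x,y)})_{x,y}$ is positive definite; $\ell_1^N$ and its subspaces have this property), a weight measure is a finite signed Borel measure $\omega$ on $K$ such that $\int_K e^{-d(x,a)}\, d\omega(x) = 1$ for all $a \in K$. Magnitude: for a finite positive definite metric space $F$ with similarity matrix $Z_F = (e^{-d(p,q)})_{p,q\in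 F}$, $\mathsf{mag}(F)$ is the sum of the components of the vector $w$ solving $Z_F w = (1,\dots,1)^T$. For compact positive definite $K$, $\mathsf{mag}(K) := \sup\{\mathsf{mag}(F) : F \subseteq K \text{ finite}\}$. It is a known fact that if $K$ admits a weight measure $\omega$, then $\mathsf{mag}(K) = \omega(K)$. *)

(* Defs.v *)
From HB Require Import structures.
From mathcomp Require Import all_boot all_order all_algebra finmap.
From mathcomp Require Import all_classical all_reals all_analysis.

Set Implicit Arguments.
Unset Strict Implicit.
Unset Printing Implicit Defensive.

Import Order.TTheory GRing.Theory Num.Theory.

Local Open Scope classical_set_scope.
Local Open Scope ring_scope.

(* Points of R^N are tuples.  The measurable sets of [N.-tuple R] in the library
   are the product sigma-algebra of the Borel sets of R, that is, the Borel
   sigma-algebra of R^N. *)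

Definition d1 (R : realType) (N : nat) (x y : N.-tuple R) : R :=
  \sum_(k < N) `|tnth x k - tnth y k|.

Definition d1_set (R : realType) (N : nat) (A : set (N.-tuple R))
    (x : N.-tuple R) : R :=
  inf [set d1 a x | a in A].

(* The infimum of the empty set in \bar R is +oo, which is the convention for
   sets with at most one point. *)
Definition skewness (R : realType) (N : nat) (S : set (N.-tuple R)) : \bar R :=
  ereal_inf [set e | exists a b : N.-tuple R, exists k : 'I_N,
    [/\ S a, S b, a != b & e = `|tnth a k - tnth b k|%:E]].

Definition cube (R : realType) (N : nat) (p : N.-tuple R) (r : R) :
    set (N.-tuple R) :=
  [set x | forall k, tnth x k \in `[tnth p k - r, tnth p k + r]].

Definition cubes (R : realType) (N : nat) (F : {fset N.-tuple R}) (r : R) :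
    set (N.-tuple R) :=
  \bigcup_(p in [set` F]) cube p r.

(* An element s of {-1,1}^N is encoded by a tuple of booleans, [true] standing
   for -1. *)
Definition sgb (R : realType) (b : bool) : R := (-1) ^+ b.

Definition vertex (R : realType) (N : nat) (p : N.-tuple R) (r : R)
    (s : N.-tuple bool) : N.-tuple R :=
  [tuple tnth p k + r * sgb R (tnth s k) | k < N].

(* Lebesgue measure on R^n, as the n-fold product of the one-dimensional one;
   on the one-point space R^0 it is the unit mass. *)
Fixpoint lebesgue_tuple (R : realType) (n : nat) : set (n.-tuple R) -> \bar R :=
  match n return set (n.-tuple R) -> \bar R with
  | 0 => fun A => \d_([tuple] : 0.-tuple R) A
  | n'.+1 => fun A =>
      (@lebesgue_measure R \x @lebesgue_tuple R n')%E
        [set z : measurableTypeR R * n'.-tuple R | A [tuple of z.1 :: z.2]]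
  end.

(* A (closed) face of the cube of centre p and radius r is encoded by
   c : 'I_N -> option bool: the k-th coordinate is free if [c k = None] and is
   fixed to p_k + r or p_k - r according to the sign b if [c k = Some b].
   The dimension of the face is the number of free coordinates. *)
Definition free_coord (N : nat) (c : {ffun 'I_N -> option bool}) : {set 'I_N} :=
  [set k | c k == None]%SET.

Definition face (R : realType) (N : nat) (p : N.-tuple R) (r : R)
    (c : {ffun 'I_N -> option bool}) : set (N.-tuple R) :=
  [set x | forall k, if c k is Some b then tnth x k = tnth p k + r * sgb R b
                     else tnth x k \in `[tnth p k - r, tnth p k + r]].

(* The isometric chart R^D -> R^N of the affine span of a D-dimensional face:
   the entries of u are placed, in order, at the free coordinates. *)
Definition face_chart (R : realType) (N : nat) (p : N.-tuple R) (r : R)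
    (c : {ffun 'I_N -> option bool}) (u : #|free_coord c|.-tuple R) :
    N.-tuple R :=
  [tuple if c k is Some b then tnth p k + r * sgb R b
         else nth 0 u (index k (enum (free_coord c))) | k < N].

Definition face_volume (R : realType) (N : nat) (p : N.-tuple R) (r : R)
    (c : {ffun 'I_N -> option bool}) (A : set (N.-tuple R)) : \bar R :=
  lebesgue_tuple [set u | (face p r c `&` A) (@face_chart R N p r c u)].

(* D-dimensional Lebesgue measure on the union of the D-dimensional faces of the
   cubes.  Summing over the faces is legitimate because, when the cubes are
   disjoint and r > 0, two distinct D-dimensional faces meet in a set of
   D-dimensional volume 0.  For D = 0 this is the counting measure on the
   vertices. *)
Definition lebesgue_skeleton (R : realType) (N : nat) (F : {fset N.-tuple R})
    (r : R) (D : nat) (A : set (N.-tuple R)) : \bar R :=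
  (\sum_(p : F) \sum_(c : {ffun 'I_N -> option bool} | #|free_coord c| == D)
     face_volume (val p) r c A)%E.

(* Integral against a signed measure, through its Jordan decomposition (which
   does not depend on the Hahn decomposition it is computed from). *)
Definition charge_integral d (T : measurableType d) (R : realType)
    (nu : {charge set T -> \bar R}) (A : set T) (f : T -> \bar R) : \bar R :=
  let PN := cid (Hahn_decomposition nu) in
  let nuPN := projT2 (cid (projT2 PN)) in
  (\int[jordan_pos nuPN]_(x in A) f x - \int[jordan_neg nuPN]_(x in A) f x)%E.

(* A finite signed Borel measure on the compact set K is a charge on R^N that is
   concentrated on K. *)
Definition weight_measure (R : realType) (N : nat) (K : set (N.-tuple R))
    (omega : {charge set (N.-tuple R) -> \bar R}) : Prop :=
  (forall A, measurable A -> A `&` K = set0 -> omega A = 0%E) /\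
  (forall a, K a ->
    charge_integral omega K (fun x => (expR (- d1 x a))%:E) = 1%E).

Definition weighting (R : realType) (N : nat) (F : {fset N.-tuple R})
    (w : F -> R) : Prop :=
  forall p : F, \sum_(q : F) expR (- d1 (val p) (val q)) * w q = 1.

(* Subspaces of l_1^N are positive definite, so a finite F has exactly one
   weighting. *)
Definition mag_fin (R : realType) (N : nat) (F : {fset N.-tuple R}) : R :=
  \sum_(p : F) xget (fun=> 0) (@weighting R N F) p.

Definition mag (R : realType) (N : nat) (K : set (N.-tuple R)) : \bar R :=
  ereal_sup [set (mag_fin G)%:E | G in [set G : {fset N.-tuple R} |
                                         [set` G] `<=` K]].

Definition coeff_system (R : realType) (N : nat) (F : {fset N.-tuple R})
    (r : R) (alpha : F -> N.-tuple bool -> R) : Prop :=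
  forall (q : F) (t : N.-tuple bool),
    \sum_(p : F) \sum_(s : N.-tuple bool)
      alpha p s * expR (- d1 (vertex (val p) r s) (vertex (val q) r t)) =
    \sum_(p : F | p != q)
      expR (- d1_set (cube (val p) r) (vertex (val q) r t)).

(* Main.v *)
From HB Require Import structures.
Require Import Defs.
From mathcomp Require Import all_boot all_order all_algebra finmap.
From mathcomp Require Import all_classical all_reals all_analysis.
From mathcomp Require Import measurable_realfun ring lra.

Set Implicit Arguments.
Unset Strict Implicit.
Unset Printing Implicit Defensive.

Import Order.TTheory GRing.Theory Num.Theory.
Import numFieldNormedType.Exports.

Local Open Scope classical_set_scope.
Local Open Scope ring_scope.

(** Positivity drives every part of the proof.  On the real line the kernel
e^(-|x-y|) is the Gram kernel of the functions e^(-x) 1[t <= x], since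
e^(-|x-y|) = e^(-x) e^(-y) e^(2 min(x,y)) and e^(2 min(x,y)) is a positive
combination of products 1[t <= x] 1[t <= y].  Taking products over the
coordinates, the kernel e^(-d1(x,y)) is positive definite on finite subsets
([d1_gram], [d1_psd]), and linear systems with such a matrix have a unique
solution ([d1_system_unique]).  This gives the coefficients alpha and the
weightings of finite spaces.

Statements about signed measures reduce to finite ones by discretization: on a
fine net of a totally bounded set K, a finite signed measure is replaced by
point masses with almost the same potential a |-> int e^(-d1(x,a))
([discretize_signed]).  If the potential of a signed measure is 1 on K, then
comparing its discretization with weightings of finite subsets of K through
positive semidefiniteness shows that the magnitude of K is the total mass
([mag_weight]).  If the potential is 0 on K, then the energy is 0 and the
Cauchy-Schwarz inequality forces the potential to vanish on all of R^N
([potential_eq0]).  A measure is determined by its potential on R^N: limits of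
linear combinations of translates of e^(-|x|) give, one coordinate at a time,
the indicator functions of half-lines, hence of orthants, and orthants form a
pi-system that generates the Borel sets ([potential_inj]).  So a weight measure
is unique ([weight_measure_unique]).

It remains to check that the stated measure is a weight measure.  Half the sum
of Lebesgue measure on [c-r,c+r] and the two unit masses at c-r and c+r has
potential e^(-dist(a,[c-r,c+r])) ([integral_expR_dist_itv]).  The volume
measures of all the faces of a cube, divided by 2^N, add up to the product of
these measures over the coordinates; its potential is e^(-d1(C_p,a)), and its
mass is (1+r)^N.  Thus on the cube C_q the sum over all cubes has potential
1 + sum_(p <> q) e^(-d1(C_p,a)).  By skewness the intervals that are the
projections of the cubes to a coordinate axis are pairwise disjoint, so on C_q
the excess sum and the potentials of the vertices are both sums of products of
functions A e^y + B e^(-y) of the coordinates.  A function of that kind on an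
interval is determined by its values at the two endpoints
([sinh_interpolation]).  Therefore the linear system, which makes the
potential of the alpha's equal to the excess at the vertices of C_q, makes
them equal on the whole of C_q ([coeff_system_cube]). *)

(** * Positive definiteness of the exponential kernel of l_1^N *)

Section d1_theory.
Context (R : realType) (N : nat).
Implicit Types x y z a : N.-tuple R.

Lemma d1C x y : d1 x y = d1 y x.
Proof. by apply: eq_bigr => k _; rewrite distrC. Qed.

Lemma d1xx x : d1 x x = 0.
Proof. by rewrite /d1 big1// => k _; rewrite subrr normr0. Qed.

Lemma d1_ge0 x y : 0 <= d1 x y. Proof. exact: sumr_ge0. Qed.

Lemma d1_triangle y x z : d1 x z <= d1 x y + d1 y z.
Proof.
rewrite /d1 -big_split/=; apply: ler_sum => k _.
by rewrite (le_trans _ (ler_normD _ _))// addrA subrK.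
Qed.

Lemma expR_d1_le1 x y : expR (- d1 x y) <= 1.
Proof. by rewrite -[leRHS]expR0 ler_expR oppr_le0 d1_ge0. Qed.

Lemma norm_expR_d1 x y : `|expR (- d1 x y)| <= 1.
Proof. by rewrite ger0_norm ?expR_ge0// expR_d1_le1. Qed.

Lemma expR_d1_lipschitz x y a : `|expR (- d1 x a) - expR (- d1 y a)| <= d1 x y.
Proof.
have H u v : expR (- d1 u a) - expR (- d1 v a) <= d1 u v.
  have [uv|uv] := leP (d1 u a) (d1 v a); last first.
    by rewrite (le_trans _ (d1_ge0 _ _))// subr_le0 ler_expR lerN2 ltW.
  rewrite (_ : - d1 v a = - d1 u a + - (d1 v a - d1 u a)); last by ring.
  rewrite expRD -[X in X - _]mulr1 -mulrBr.
  have ge1 := expR_ge1Dx (- (d1 v a - d1 u a)).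
  have le1 := expR_d1_le1 u a; have ge0 := expR_ge0 (- d1 u a).
  have tri := d1_triangle u v a; rewrite (d1C v u) in tri.
  apply: (@le_trans _ _ (expR (- d1 u a) * (d1 v a - d1 u a))).
    by apply: ler_wpM2l => //; lra.
  have D0 : 0 <= d1 v a - d1 u a by rewrite subr_ge0.
  have := ler_piMl D0 le1; lra.
by rewrite ler_norml (H x y) andbT lerNl opprB (d1C x y) (H y x).
Qed.

Lemma expR_d1 x y :
  expR (- d1 x y) = \prod_(k < N) expR (- `|tnth x k - tnth y k|).
Proof. by rewrite /d1 -sumrN expR_sum. Qed.

End d1_theory.

(** An increasing function on a finite chain is the sum of its increments; on a
list sorted upwards, subtract the value at the first point and recurse. *)
Lemma monotone_step_sum (R : realType) (g : R -> R) (T : seq R) :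
  sorted <%R T -> {in T, forall t, 0 < g t} ->
  {in T &, {homo g : x y / x < y}} ->
  exists2 c : R -> R, {in T, forall t, 0 < c t} &
    {in T, forall x, g x = \sum_(t <- T) c t * (t <= x)%R%:R}.
Proof.
elim: T g => [|a T IH] g /= sT g0 gh; first by exists (fun=> 1).
have aT t : t \in T -> a < t.
  by move=> tT; move: sT; rewrite lt_path_sortedE => /andP[/allP /(_ _ tT)].
have [||| c c0 cE] := IH (fun x => g x - g a).
- exact: path_sorted sT.
- move=> t tT; rewrite subr_gt0; apply: gh; rewrite ?mem_head ?aT//.
  by rewrite in_cons tT orbT.
- move=> x y xT yT xy; rewrite ltrD2r; apply: gh => //;
    by rewrite in_cons (xT, yT) orbT.
exists (fun t => if t == a then g a else c t).
  move=> t; rewrite in_cons; case: eqP => [-> _|_ /= tT]; last exact: c0.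
  by apply: g0; rewrite mem_head.
have cT x : \sum_(t <- T) (if t == a then g a else c t) * (t <= x)%R%:R =
            \sum_(t <- T) c t * (t <= x)%R%:R.
  rewrite !big_seq; apply: eq_bigr => t /aT.
  by case: eqP => [->|//]; rewrite ltxx.
move=> x; rewrite in_cons big_cons eqxx cT => /orP[/eqP ->|xT].
  rewrite lexx mulr1 big_seq big1 ?addr0// => t /aT at'.
  by rewrite leNgt at' mulr0.
by rewrite (ltW (aT _ xT)) mulr1 -(cE _ xT) addrC subrK.
Qed.

(** The previous lemma for e^(2x), evaluated at the smaller of [x] and [y]. *)
Lemma expR_dist_step_sum (R : realType) (T : seq R) : sorted <%R T ->
  exists2 c : R -> R, {in T, forall t, 0 < c t} &
    {in T &, forall x y, expR (- `|x - y|) =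
      \sum_(t <- T) c t * ((expR (- x) * (t <= x)%R%:R) *
                           (expR (- y) * (t <= y)%R%:R))}.
Proof.
move=> sT; have [||c c0 cE] := @monotone_step_sum R (fun x => expR (x *+ 2)) T sT.
- by move=> t _; exact: expR_gt0.
- by move=> x y _ _ xy; rewrite ltr_expR ltr_pMn2r.
exists c => // x y; wlog xy : x y / x <= y => [H xT yT|xT yT].
  have [|/ltW yx] := leP x y; first by move=> ?; exact: H.
  rewrite distrC H//; apply: eq_bigr => t _.
  by rewrite [X in _ * X]mulrC.
rewrite distrC ger0_norm ?subr_ge0//.
have -> : - (y - x) = - x + - y + x *+ 2 by rewrite mulr2n; ring.
rewrite expRD expRD cE// mulr_sumr; apply: eq_bigr => t _.
have [tx|_] := leP t x; last by rewrite !(mulr0, mul0r).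
by rewrite (le_trans tx xy) /=; ring.
Qed.

(** Expanding the product over the coordinates of the one-dimensional
decompositions gives features indexed by the grid points that the coordinates
of the family span; each feature is supported on an orthant.  Injectivity gives
strictness: for a point of the support of [v] whose sum of coordinates is
maximal, the orthant at that point contains no other point of the support. *)
Lemma d1_gram (R : realType) (N : nat) (I : finType) (x : I -> N.-tuple R) :
  exists (L : finType) (c : L -> R) (u : L -> I -> R),
  [/\ forall l, 0 < c l,
      forall i j, expR (- d1 (x i) (x j)) = \sum_l c l * (u l i * u l j) &
      injective x -> forall v : I -> R,
        (forall l, \sum_i v i * u l i = 0) -> forall i, v i = 0].
Proof.
pose T := sort <=%R (undup [seq tnth (x z.1) z.2 | z <- enum {: I * 'I_N}]).
have sT : sorted <%R T by rewrite lt_sorted_uniq_le sort_uniq undup_uniq sort_le_sorted.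
have xT i k : tnth (x i) k \in T.
  rewrite mem_sort mem_undup; apply/mapP; exists (i, k) => //.
  by rewrite mem_enum.
have [b b0 bE] := expR_dist_step_sum sT.
pose t (l : {ffun 'I_N -> 'I_(size T)}) k := tnth (in_tuple T) (l k).
exists {ffun 'I_N -> 'I_(size T)}, (fun l => \prod_k b (t l k)),
  (fun l i => \prod_k (expR (- tnth (x i) k) * (t l k <= tnth (x i) k)%R%:R)).
split.
- move=> l; apply: prodr_gt0 => k _; apply: b0; exact: mem_tnth.
- move=> i j; rewrite expR_d1.
  transitivity (\prod_k \sum_(s < size T)
    let t := tnth (in_tuple T) s in b t *
     ((expR (- tnth (x i) k) * (t <= tnth (x i) k)%R%:R) *
     (expR (- tnth (x j) k) * (t <= tnth (x j) k)%R%:R))).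
    by apply: eq_bigr => k _; rewrite bE// big_tnth.
  rewrite bigA_distr_bigA /=; apply: eq_bigr => l _.
  by rewrite !big_split.
move=> xinj v v0 i0; apply/eqP; apply: contraT => vi0.
pose S (i : I) := \sum_k tnth (x i) k.
(* A point of the support with maximal coordinate sum sees no other point of it. *)
case: (@Order.TotalTheory.arg_maxP _ _ _ i0 (fun i => v i != 0) S vi0) => i vi iM.
have iP k : exists l : 'I_(size T), tnth (in_tuple T) l == tnth (x i) k.
  have /tnthP[l lE] : tnth (x i) k \in in_tuple T by exact: xT.
  by exists l; rewrite lE.
pose l := [ffun k => xchoose (iP k)].
have tl k : t l k = tnth (x i) k by rewrite /t ffunE; exact/eqP/(xchooseP (iP k)).
have := v0 l; rewrite (bigD1 i)//= [X in _ + X]big1 ?addr0 => [/eqP|j ji].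
  rewrite mulf_eq0 (negbTE vi)/= => /eqP E0; suff : 0 < 0 :> R by rewrite ltxx.
  rewrite -[X in _ < X]E0; apply: prodr_gt0 => k _.
  by rewrite tl lexx mulr1 expR_gt0.
have [->|vj] := eqVneq (v j) 0; first by rewrite mul0r.
have [/forallP xij|/forallPn[k xij]] := boolP [forall k, tnth (x i) k <= tnth (x j) k];
  last by rewrite (bigD1 k)//= tl (negbTE xij) mulr0 mul0r mulr0.
suff : j = i by move=> E; rewrite E eqxx in ji.
apply/xinj/esym/eq_from_tnth => k; apply/eqP; rewrite -subr_eq0 -oppr_eq0 opprB.
have /eqP : \sum_k (tnth (x j) k - tnth (x i) k) = 0.
  apply/eqP; rewrite eq_le sumr_ge0 ?andbT; last first.
    by move=> ? _; rewrite subr_ge0.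
  by rewrite sumrB subr_le0; exact: iM.
rewrite psumr_eq0; last by move=> ? _; rewrite subr_ge0.
by move=> /allP/(_ k); rewrite mem_index_enum => /(_ isT).
Qed.

Lemma gram_energy (R : realType) (N : nat) (I L : finType)
    (x : I -> N.-tuple R) (c : L -> R) (u : L -> I -> R) (v : I -> R) :
  (forall i j, expR (- d1 (x i) (x j)) = \sum_l c l * (u l i * u l j)) ->
  \sum_i \sum_j v i * v j * expR (- d1 (x i) (x j)) =
  \sum_l c l * (\sum_i v i * u l i) ^+ 2.
Proof.
move=> cE.
transitivity (\sum_i \sum_j \sum_l c l * ((v i * u l i) * (v j * u l j))).
  apply: eq_bigr => i _; apply: eq_bigr => j _; rewrite cE mulr_sumr.
  by apply: eq_bigr => l _; ring.
under eq_bigr do rewrite exchange_big /=.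
rewrite exchange_big /=; apply: eq_bigr => l _.
rewrite expr2 mulr_suml mulr_sumr; apply: eq_bigr => i _.
by rewrite !mulr_sumr; apply: eq_bigr => j _; ring.
Qed.

Lemma d1_psd (R : realType) (N : nat) (I : finType) (x : I -> N.-tuple R)
    (v : I -> R) :
  0 <= \sum_i \sum_j v i * v j * expR (- d1 (x i) (x j)).
Proof.
have [L [c [u [c0 cE _]]]] := d1_gram x.
rewrite (gram_energy _ cE).
by apply: sumr_ge0 => l _; rewrite mulr_ge0 ?sqr_ge0// ltW.
Qed.

(** Semidefiniteness for the signed family [v] - [w]; this replaces the inequality
of Cauchy and Schwarz below. *)
Lemma d1_psd_sub (R : realType) (N : nat) (I J : finType) (x : I -> N.-tuple R)
    (y : J -> N.-tuple R) (v : I -> R) (w : J -> R) :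
  2 * (\sum_i \sum_j v i * w j * expR (- d1 (x i) (y j))) <=
  \sum_i \sum_j v i * v j * expR (- d1 (x i) (x j)) +
  \sum_i \sum_j w i * w j * expR (- d1 (y i) (y j)).
Proof.
have := d1_psd (fun i : I + J => match i with inl i => x i | inr i => y i end)
  (fun i : I + J => match i with inl i => v i | inr i => - w i end).
rewrite big_sumType /=.
under eq_bigr do rewrite big_sumType /=.
under [X in _ + X]eq_bigr do rewrite big_sumType /=.
rewrite !big_split /=.
have -> : \sum_i \sum_j v i * - w j * expR (- d1 (x i) (y j)) =
   - \sum_i \sum_j v i * w j * expR (- d1 (x i) (y j)).
  by rewrite -sumrN; apply: eq_bigr => i _; rewrite -sumrN; apply: eq_bigr => j _; ring.
have -> : \sum_i \sum_j - w i * v j * expR (- d1 (y i) (x j)) =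
   - \sum_i \sum_j v i * w j * expR (- d1 (x i) (y j)).
  rewrite exchange_big -sumrN; apply: eq_bigr => i _; rewrite -sumrN.
  by apply: eq_bigr => j _; rewrite d1C; ring.
have -> : \sum_i \sum_j - w i * - w j * expR (- d1 (y i) (y j)) =
   \sum_i \sum_j w i * w j * expR (- d1 (y i) (y j)).
  by apply: eq_bigr => i _; apply: eq_bigr => j _; ring.
set A := \sum_i _; set B := \sum_i _; set C := \sum_i _ => H.
lra.
Qed.

(** A vector in the kernel of the similarity matrix has zero energy. *)
Lemma d1_system_unique (R : realType) (N : nat) (I : finType)
    (x : I -> N.-tuple R) (xinj : injective x) (b : I -> R) :
  exists2 w : I -> R,
    forall j, \sum_i w i * expR (- d1 (x i) (x j)) = b j &
    forall w', (forall j, \sum_i w' i * expR (- d1 (x i) (x j)) = b j) ->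
      w' = w.
Proof.
have ker (v : I -> R) : (forall j, \sum_i v i * expR (- d1 (x i) (x j)) = 0) ->
    forall i, v i = 0.
  move=> v0; have [L [c [u [c0 cE uinj]]]] := d1_gram x.
  apply: uinj => // l.
  have : \sum_l c l * (\sum_i v i * u l i) ^+ 2 = 0.
    rewrite -(gram_energy _ cE) exchange_big big1// => j _ /=.
    by under eq_bigr do rewrite mulrAC; rewrite -mulr_suml v0 mul0r.
  move/eqP; rewrite psumr_eq0; last first.
    by move=> l' _; rewrite mulr_ge0 ?sqr_ge0 ?ltW.
  move=> /allP/(_ l); rewrite mem_index_enum => /(_ isT)/=.
  by rewrite mulf_eq0 gt_eqF//= sqrf_eq0 => /eqP.
pose Z := \matrix_(i < #|I|, j < #|I|) expR (- d1 (x (enum_val i)) (x (enum_val j))) : 'M[R]__.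
have mulZ (w : I -> R) j :
    ((\row_i w (enum_val i)) *m Z) 0 j = \sum_i w i * expR (- d1 (x i) (x (enum_val j))).
  rewrite mxE (reindex (@enum_val I predT)) /=; last exact: onW_bij (enum_val_bij I).
  by apply: eq_bigr => i _; rewrite !mxE.
have Zfree : row_free Z.
  apply: inj_row_free => v vZ.
  have := ker (fun i => v 0 (enum_rank i)); move=> kv.
  apply/rowP => i; rewrite [RHS]mxE -[i]enum_valK kv// => j.
  rewrite -[j]enum_rankK -mulZ (_ : \row_i _ = v) ?vZ ?mxE//.
  by apply/rowP => k; rewrite mxE enum_valK.
have Zu : Z \in unitmx by rewrite -row_free_unit.
pose w := (\row_j b (enum_val j)) *m invmx Z.
have wE j : \sum_i w 0 (enum_rank i) * expR (- d1 (x i) (x j)) = b j.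
  rewrite -{1}[j]enum_rankK -mulZ (_ : \row_i _ = w); last first.
    by apply/rowP => k; rewrite mxE enum_valK.
  by rewrite mulmxKV// mxE enum_rankK.
exists (fun i => w 0 (enum_rank i)) => // w' w'E.
apply/funext => i; apply/eqP; rewrite -subr_eq0; apply/eqP.
apply: (ker (fun i => w' i - w 0 (enum_rank i))) => j.
under eq_bigr do rewrite mulrBl.
by rewrite sumrB wE w'E subrr.
Qed.

(** * Lebesgue measure on tuples and integrals of product functions *)

Section cons_measure.
Context (R : realType) (n : nat).
Variable mu : {sigma_finite_measure set (n.-tuple R) -> \bar R}.

Let f (z : measurableTypeR R * n.-tuple R) : n.+1.-tuple R :=
  [tuple of z.1 :: z.2].

Let mf : measurable_fun setT f. Proof. exact: measurable_cons. Qed.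

(** The successor step of [lebesgue_tuple], with the recursive call replaced by a
measure in order that the result is a measure too. *)
Definition cons_measure (A : set (n.+1.-tuple R)) : \bar R :=
  (@lebesgue_measure R \x mu)%E (f @^-1` A).

Let cons_measure0 : cons_measure set0 = 0%E.
Proof. by rewrite /cons_measure preimage_set0 measure0. Qed.

Let cons_measure_ge0 A : (0 <= cons_measure A)%E.
Proof. exact: measure_ge0. Qed.

Let cons_measure_sigma_additive : semi_sigma_additive cons_measure.
Proof.
move=> F mF tF mUF; rewrite /cons_measure preimage_bigcup.
apply: measure_semi_sigma_additive.
- by move=> k; rewrite -[X in measurable X]setTI; exact: mf.
- apply/trivIsetP => /= i j _ _ ij; rewrite -preimage_setI.
  by move/trivIsetP : tF => /(_ _ _ _ _ ij) ->//; rewrite preimage_set0.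
- by rewrite -preimage_bigcup -[X in measurable X]setTI; exact: mf.
Qed.

HB.instance Definition _ := isMeasure.Build _ _ _ cons_measure
  cons_measure0 cons_measure_ge0 cons_measure_sigma_additive.

Let cons_measure_sigma_finite : sigma_finite setT cons_measure.
Proof.
have /sigma_finiteP[F [FT ndF Foo]] := sigma_finiteT (@lebesgue_measure R).
have /sigma_finiteP[G [GT ndG Goo]] := sigma_finiteT mu.
pose h (x : n.+1.-tuple R) : measurableTypeR R := tnth x ord0.
pose b (x : n.+1.-tuple R) : n.-tuple R := [tuple of behead x].
have mh : measurable_fun setT h by exact: measurable_tnth.
have mb : measurable_fun setT b by exact: measurable_behead.
exists (fun k => h @^-1` F k `&` b @^-1` G k).
  apply/seteqP; split => // x _.
  have [i _ Fi] : (\bigcup_i F i) (h x) by rewrite -FT.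
  have [j _ Gj] : (\bigcup_i G i) (b x) by rewrite -GT.
  exists (maxn i j) => //; split.
  - by have /subsetPset := ndF _ _ (leq_maxl i j); exact.
  - by have /subsetPset := ndG _ _ (leq_maxr i j); exact.
move=> k; have [mFk Fkoo] := Foo k; have [mGk Gkoo] := Goo k; split.
  apply: measurableI; rewrite -[X in measurable X]setTI; [exact: mh|exact: mb].
rewrite /cons_measure (_ : f @^-1` _ = F k `*` G k); last first.
  by apply/seteqP; split => -[x y] /=; rewrite /h /b/= (_ : [tuple of _] = y)//;
    exact/val_inj.
by rewrite product_measure1E// lte_mul_pinfty// ge0_fin_numE.
Qed.

HB.instance Definition _ := Measure_isSigmaFinite.Build _ _ _ cons_measure
  cons_measure_sigma_finite.

Lemma ge0_integral_cons_measure (h : n.+1.-tuple R -> \bar R) :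
  measurable_fun [set: n.+1.-tuple R] h -> (forall x, 0 <= h x)%E ->
  (\int[cons_measure]_x h x =
   \int[@lebesgue_measure R]_x \int[mu]_y h [tuple of x :: y])%E.
Proof.
move=> mh h0; rewrite [LHS](ge0_integral_pushforward mf)//= preimage_setT.
rewrite (fubini_tonelli1 (h \o f))//; first exact: measurableT_comp.
by move=> x; exact: h0.
Qed.

End cons_measure.

Lemma lebesgue_tuple_sigma_finite (R : realType) (n : nat) :
  exists mu : {sigma_finite_measure set (n.-tuple R) -> \bar R},
    (mu : set (n.-tuple R) -> \bar R) = @lebesgue_tuple R n.
Proof.
elim: n => [|n [mu muE]].
  by exists (@dirac _ (0.-tuple R) [tuple] R).
by exists (cons_measure mu); rewrite /= -muE.
Qed.

Lemma measurable_prod_tnth (R : realType) (n : nat) (g : 'I_n -> R -> R) :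
  (forall k, measurable_fun setT (g k)) ->
  measurable_fun [set: n.-tuple R] (fun u => \prod_k g k (tnth u k)).
Proof.
move=> mg; apply: measurable_prod => k _.
by apply: (measurableT_comp (mg k)); exact: measurable_tnth.
Qed.

(** Induction on the dimension by the theorem of Fubini and Tonelli. *)
Lemma integral_lebesgue_tuple_prod (R : realType) (n : nat)
    (g : 'I_n -> R -> R) (G : 'I_n -> R) :
  (forall k, measurable_fun setT (g k)) -> (forall k x, 0 <= g k x) ->
  (forall k, \int[@lebesgue_measure R]_x (g k x)%:E = (G k)%:E)%E ->
  (\int[@lebesgue_tuple R n]_u (\prod_k g k (tnth u k))%:E =
   (\prod_k G k)%:E)%E.
Proof.
elim: n g G => [|n IH] g G mg g0 gE.
  rewrite big_ord0 (_ : (fun u => _) = cst 1%E); last first.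
    by apply/funext => u; rewrite big_ord0.
  rewrite (_ : @lebesgue_tuple R 0 = @dirac _ (0.-tuple R) [tuple] R)//.
  by rewrite integral_cst//= diracE mem_set// mule1.
have [mu muE] := lebesgue_tuple_sigma_finite R n.
rewrite (_ : @lebesgue_tuple R n.+1 = cons_measure mu); last by rewrite /= -muE.
rewrite ge0_integral_cons_measure; last 2 first.
- by apply/measurable_EFinP; exact: measurable_prod_tnth.
- by move=> u; rewrite lee_fin prodr_ge0.
have G0 k : 0 <= G k by rewrite -lee_fin -gE integral_ge0// => x _; rewrite lee_fin.
transitivity (\int[@lebesgue_measure R]_x
   ((\prod_(k < n) G (lift ord0 k))%:E * (g ord0 x)%:E))%E.
  apply: eq_integral => x _.
  rewrite -[RHS]muleC -(IH (fun k => g (lift ord0 k)))// -muE.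
  rewrite -ge0_integralZl//; last 3 first.
  - apply/measurable_EFinP.
    exact: (@measurable_prod_tnth _ _ (fun k => g (lift ord0 k))).
  - by move=> u _; rewrite lee_fin prodr_ge0.
  - by rewrite lee_fin.
  apply: eq_integral => u _; rewrite big_ord_recl EFinM; congr (_ * (_)%:E)%E.
  by apply: eq_bigr => k _; rewrite tnthS.
rewrite ge0_integralZl//; last 3 first.
- by apply/measurable_EFinP; exact: mg.
- by move=> u _; rewrite lee_fin.
- by rewrite lee_fin prodr_ge0.
by rewrite gE big_ord_recl -EFinM mulrC.
Qed.

(** * Volume measures of the faces of a cube *)

(** Image measures restricted to a set of finite mass.  The intersection is
written with [D] on the left so that [face_volume] is convertible to an
instance. *)
Section pushforward_restr.
Context d1 d2 (T1 : measurableType d1) (T2 : measurableType d2) (R : realType).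
Variables (mu : {measure set T1 -> \bar R}) (f : T1 -> T2) (D : set T2).
Hypotheses (mf : measurable_fun setT f) (mD : measurable D).
Hypothesis muD : (mu (f @^-1` D) < +oo)%E.

Definition pushforward_restr (A : set T2) : \bar R := mu (f @^-1` (D `&` A)).

Let pushforward_restr0 : pushforward_restr set0 = 0%E.
Proof. by rewrite /pushforward_restr setI0 preimage_set0 measure0. Qed.

Let pushforward_restr_ge0 A : (0 <= pushforward_restr A)%E.
Proof. exact: measure_ge0. Qed.

Let pushforward_restr_sigma_additive : semi_sigma_additive pushforward_restr.
Proof.
have mfD A : measurable A -> measurable (f @^-1` (D `&` A)).
  by move=> mA; rewrite -[X in measurable X]setTI; apply: mf => //; exact: measurableI.
move=> F mF tF mUF; rewrite /pushforward_restr setI_bigcupr preimage_bigcup.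
apply: measure_semi_sigma_additive.
- by move=> k; exact: mfD.
- apply/trivIsetP => /= i j _ _ ij; rewrite -preimage_setI setIACA setIid.
  by move/trivIsetP : tF => /(_ _ _ _ _ ij) ->//; rewrite setI0 preimage_set0.
- by rewrite -preimage_bigcup -setI_bigcupr; exact: mfD.
Qed.

HB.instance Definition _ := isMeasure.Build _ _ _ pushforward_restr
  pushforward_restr0 pushforward_restr_ge0 pushforward_restr_sigma_additive.

Let pushforward_restr_fin : fin_num_fun pushforward_restr.
Proof.
by apply: lty_fin_num_fun; 
  change (mu (f @^-1` (D `&` setT)) < +oo)%E; rewrite setIT.
Qed.

HB.instance Definition _ := @Measure_isFinite.Build _ _ _
  pushforward_restr pushforward_restr_fin.

End pushforward_restr.

Lemma ge0_integral_concentrated d (T : measurableType d) (R : realType)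
    (mu : {measure set T -> \bar R}) (D : set T) (f : T -> \bar R) :
  measurable D -> mu (~` D) = 0%E -> measurable_fun setT f ->
  (forall x, 0 <= f x)%E ->
  (\int[mu]_x f x = \int[mu]_(x in D) f x)%E.
Proof.
move=> mD muD0 mf f0.
rewrite (@ge0_negligible_integral _ _ _ mu _ (~` D))//; last exact: measurableC.
by rewrite setTD setCK.
Qed.

Lemma ge0_integral_pushforward_restr d1 d2 (T1 : measurableType d1)
    (T2 : measurableType d2) (R : realType) (mu : {measure set T1 -> \bar R})
    (f : T1 -> T2) (D : set T2) (mf : measurable_fun setT f)
    (mD : measurable D) (h : T2 -> \bar R) :
  measurable_fun setT h -> (forall x, 0 <= h x)%E ->
  (\int[pushforward_restr mu f D]_x h x = \int[mu]_(x in f @^-1` D) h (f x))%E.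
Proof.
move=> mh h0.
rewrite (@ge0_integral_concentrated _ _ _ (pushforward_restr mu f D : {measure set _ -> \bar R}) D)//; last first.
  by rewrite /= /pushforward_restr setICr preimage_set0 measure0.
rewrite -(ge0_integral_pushforward mf)//; first last.
  exact: measurable_funTS.
apply: eq_measure_integral => A mA AD.
by change (mu (f @^-1` (D `&` A)) = mu (f @^-1` A)); rewrite setIidr.
Qed.

Lemma measurable_box (R : realType) (N : nat) (S : 'I_N -> set R) :
  (forall k, measurable (S k)) ->
  measurable [set x : N.-tuple R | forall k, S k (tnth x k)].
Proof.
move=> mS; rewrite (_ : [set x | _] =
    \bigcap_(k in [set: 'I_N]) ((@tnth N R)^~ k @^-1` S k)); last first.
  by apply/seteqP; split => x Sx k; [move=> _|]; exact: Sx.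
apply: fin_bigcap_measurable => // k _.
by rewrite -[X in measurable X]setTI; exact: measurable_tnth.
Qed.

Section face.
Context (R : realType) (N : nat) (p : N.-tuple R) (r : R).
Variable c : {ffun 'I_N -> option bool}.
Local Notation D := #|free_coord c|.

Definition face_side (k : 'I_N) : set R :=
  if c k is Some b then [set tnth p k + r * sgb R b]
  else [set` `[tnth p k - r, tnth p k + r]].

Lemma face_sideE : face p r c = [set x | forall k, face_side k (tnth x k)].
Proof.
by apply/seteqP; split => x Fx k; have := Fx k; rewrite /face_side; case: (c k).
Qed.

Lemma measurable_face_side k : measurable (face_side k).
Proof. by rewrite /face_side; case: (c k). Qed.

Lemma measurable_face : measurable (face p r c).
Proof. by rewrite face_sideE; apply: measurable_box => k; exact: measurable_face_side. Qed.

Lemma measurable_face_chart :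
  measurable_fun [set: D.-tuple R] (face_chart p r (c := c)).
Proof.
apply/measurable_fun_tnthP => k.
rewrite (_ : _ \o _ = fun u : D.-tuple R => if c k is Some b
  then tnth p k + r * sgb R b else nth 0 u (index k (enum (free_coord c)))); last first.
  by apply/funext => u; rewrite /= tnth_mktuple.
case E : (c k) => [b|]; first exact: measurable_cst.
have kD : (index k (enum (free_coord c)) < D)%N.
  by rewrite cardE index_mem mem_enum inE E.
rewrite (_ : (fun u : D.-tuple R => _) = fun u => tnth u (Ordinal kD)); last first.
  by apply/funext => u; rewrite (tnth_nth 0).
exact: measurable_tnth.
Qed.

Lemma face_chart_enum_val (u : D.-tuple R) (j : 'I_D) :
  tnth (face_chart p r u) (enum_val j) = tnth u j.
Proof.
rewrite tnth_mktuple; have := enum_valP j; rewrite inE => /eqP ->.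
rewrite (tnth_nth 0); congr nth.
rewrite /enum_val index_uniq ?enum_uniq// -cardE; exact: ltn_ord.
Qed.

(** The chart splits the product into the fixed coordinates, which contribute a
constant, and the free ones, which are the coordinates of the chart. *)
Lemma integral_face_chart_prod (g : 'I_N -> R -> R) (G : 'I_N -> R) :
  (forall k, measurable_fun setT (g k)) -> (forall k x, 0 <= g k x) ->
  (forall k, if c k is Some b then g k (tnth p k + r * sgb R b) = G k
   else (\int[@lebesgue_measure R]_(x in [set` `[(tnth p k - r)%R, (tnth p k + r)%R]])
           (g k x)%:E = (G k)%:E)%E) ->
  (\int[@lebesgue_tuple R D]_(u in face_chart p r (c := c) @^-1` face p r c)
     (\prod_k g k (tnth (face_chart p r u) k))%:E = (\prod_k G k)%:E)%E.
Proof.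
move=> mg g0 gG.
pose h k x := g k x * \1_(face_side k) x.
have mh k : measurable_fun setT (h k).
  apply: measurable_funM => //; apply: measurable_indic.
  exact: measurable_face_side.
have h0 k x : 0 <= h k x by rewrite mulr_ge0.
have [mu muE] := lebesgue_tuple_sigma_finite R D; rewrite -muE.
transitivity (\int[mu]_u
   ((\prod_(k | k \notin free_coord c) G k)%:E *
    (\prod_(j < D) h (enum_val j) (tnth u j))%:E))%E.
  rewrite integral_mkcond; apply: eq_integral => u _.
  rewrite patchE -EFinM.
  rewrite [X in (_ * X)%R](_ : _ = \prod_(k in free_coord c)
     h k (tnth (face_chart p r u) k)); last first.
    by rewrite [RHS]big_enum_val; apply: eq_bigr => j _; rewrite face_chart_enum_val.
  have -> : \prod_(k | k \notin free_coord c) G k =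
      \prod_(k | k \notin free_coord c) h k (tnth (face_chart p r u) k).
    apply: eq_bigr => k; rewrite inE /h /face_side tnth_mktuple; have := gG k.
    case: (c k) => // b <- _.
    by rewrite indicE mem_set// mulr1.
  rewrite mulrC -(bigID (mem (free_coord c)) predT (fun k => h k (tnth (face_chart p r u) k)))/=.
  case: ifPn => [|].
    rewrite inE /= face_sideE => Fu.
    by congr (_%:E); apply: eq_bigr => k _; rewrite /h indicE mem_set// mulr1.
  rewrite notin_setE /= face_sideE => /existsNP[k Fk].
  by rewrite (bigD1 k)//= /h indicE memNset// mulr0 mul0r.
rewrite ge0_integralZl//; last 3 first.
- apply/measurable_EFinP.
  exact: (@measurable_prod_tnth _ _ (fun j => h (enum_val j))).
- by move=> u _; rewrite lee_fin prodr_ge0.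
- rewrite lee_fin prodr_ge0// => k; have := gG k.
  by rewrite inE; case: (c k) => // b <-.
have := @integral_lebesgue_tuple_prod _ _ (fun j : 'I_D => h (enum_val j))
  (fun j => G (enum_val j)); rewrite -muE => ->//; last first.
  move=> j; have := gG (enum_val j); have := enum_valP j.
  rewrite inE /h /face_side => /eqP -> <-.
  rewrite [RHS]integral_mkcond; apply: eq_integral => x _.
  by rewrite patchE indicE; case: ifPn => _; rewrite ?mulr1 ?mulr0.
rewrite -(big_enum_val G)/= -EFinM mulrC.
by rewrite -(bigID (mem (free_coord c)) predT G).
Qed.

(** The measure is packaged with its integrals of product functions because both
potentials and masses are such integrals. *)
Lemma face_volume_finite_measure :
  exists2 nu : {finite_measure set (N.-tuple R) -> \bar R},
    (nu : set (N.-tuple R) -> \bar R) = face_volume p r c &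
    forall (g : 'I_N -> R -> R) (G : 'I_N -> R),
    (forall k, measurable_fun setT (g k)) -> (forall k x, 0 <= g k x) ->
    (forall k, if c k is Some b then g k (tnth p k + r * sgb R b) = G k
     else (\int[@lebesgue_measure R]_(x in [set` `[(tnth p k - r)%R, (tnth p k + r)%R]])
             (g k x)%:E = (G k)%:E)%E) ->
    (\int[nu]_x (\prod_k g k (tnth x k))%:E = (\prod_k G k)%:E)%E.
Proof.
have [mu muE] := lebesgue_tuple_sigma_finite R D.
have mC := measurable_face_chart; have mF := measurable_face.
have muF : (mu (face_chart p r (c := c) @^-1` face p r c) < +oo)%E.
  have mCF : measurable (face_chart p r (c := c) @^-1` face p r c).
    by rewrite -[X in measurable X]setTI; exact: mC.
  pose G k : R := if c k is Some _ then 1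
     else fine (@lebesgue_measure R [set` `[tnth p k - r, tnth p k + r]]).
  have := @integral_face_chart_prod (fun _ _ => 1) G; rewrite -muE => muG.
  rewrite -[ltLHS]mul1e -integral_cst//.
  rewrite (eq_integral (fun u => (\prod_(k < N) 1)%:E)); last first.
    by move=> u _; rewrite big1.
  rewrite muG ?ltry// => k; rewrite /G; case: (c k) => //.
  by rewrite integral_cst// mul1e fineK// lebesgue_measure_itv/=; case: ifP.
unshelve refine (ex_intro2 _ _ (pushforward_restr mu
  (face_chart p r (c := c)) (face p r c) : {finite_measure set _ -> \bar R})
  _ _) => //.
  by rewrite /face_volume -muE.
move=> g G mg g0 gG; rewrite ge0_integral_pushforward_restr//; last 2 first.
- by apply/measurable_EFinP; exact: measurable_prod_tnth.
- by move=> x; rewrite lee_fin prodr_ge0.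
by have := integral_face_chart_prod mg g0 gG; rewrite -muE.
Qed.

End face.

(** * The potential of a segment with unit masses at its ends *)

Lemma integral_expR_affine (R : realType) (s a u v : R) :
  s * s = 1 -> u <= v ->
  (\int[@lebesgue_measure R]_(x in [set` `[u, v]]) (expR (s * (x - a))%R)%:E =
   (s * expR (s * (v - a)) - s * expR (s * (u - a)))%:E)%E.
Proof.
move=> ss; rewrite le_eqVlt => /predU1P[->|uv].
  by rewrite subrr set_itv1 integral_set1.
pose F x := s * expR (s * (x - a)).
have dF (x : R) : is_derive x (1 : R) F (expR (s * (x - a))).
  have -> : F = s \*: (expR \o (s \*: (id - cst a))).
    by apply/funext => y.
  apply: is_derive_eq.
  by rewrite /GRing.scale/= subr0 mulr1 mulrCA ss mulr1.
have cf : continuous (fun x => expR (s * (x - a))).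
  have -> : (fun x => expR (s * (x - a))) = expR \o (s \*: (id - cst a)) by [].
  by move=> x; apply/differentiable_continuous/derivable1_diffP; exact: ex_derive.
have cF : continuous F.
  by move=> x; apply/differentiable_continuous/derivable1_diffP; exact: ex_derive.
rewrite (@continuous_FTC2 _ _ F)//.
- by apply: continuous_subspaceT.
- split.
  + by move=> x _; exact: ex_derive.
  + exact/cvg_at_right_filter/cF.
  + exact/cvg_at_left_filter/cF.
- by move=> x _; rewrite derive1E derive_val.
Qed.

(** The distance from [a] to the interval of centre [c] and radius [r]. *)
Definition dist_itv (R : realType) (c r a : R) : R := Num.max 0 (`|c - a| - r).

(** The antiderivative of e^(-|x-a|) changes form at [a], whence the three cases:
[a] to the left of the interval, to its right, or inside.  The exponentials at
the endpoints cancel against the two point masses. *)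
Lemma integral_expR_dist_itv (R : realType) (c r a : R) : 0 <= r ->
  exists2 I : R, (\int[@lebesgue_measure R]_(x in [set` `[c - r, c + r]%R])
    (expR (- `|x - a|)%R)%:E = I%:E)%E &
   I + expR (- `|c - r - a|) + expR (- `|c + r - a|) = 2 * expR (- dist_itv c r a).
Proof.
move=> r0.
have mJ D : measurable_fun D (fun x : R => (expR (- `|x - a|))%:E).
  apply/measurable_EFinP; apply: measurable_funTS.
  apply: measurableT_comp => //; apply: measurableT_comp => //.
  apply: measurableT_comp => //; exact: measurable_funB.
have crc : c - r <= c + r by rewrite lerD2l ge0_cp.
have right u v : a <= u -> u <= v ->
  (\int[@lebesgue_measure R]_(x in [set` `[u, v]%R]) (expR (- `|x - a|)%R)%:E =
    (expR (a - u) - expR (a - v))%:E)%E.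
  move=> au uv; transitivity (\int[@lebesgue_measure R]_(x in [set` `[u, v]%R])
    (expR (-1 * (x - a))%R)%:E)%E; last first.
    rewrite integral_expR_affine ?mulrNN ?mulr1// !mulN1r !opprB; congr (_%:E).
    by rewrite opprK addrC.
  apply: eq_integral => x; rewrite inE/= in_itv/= => /andP[ux _].
  by rewrite mulN1r ger0_norm// subr_ge0 (le_trans au).
have left u v : v <= a -> u <= v ->
  (\int[@lebesgue_measure R]_(x in [set` `[u, v]%R]) (expR (- `|x - a|)%R)%:E =
    (expR (v - a) - expR (u - a))%:E)%E.
  move=> va uv; transitivity (\int[@lebesgue_measure R]_(x in [set` `[u, v]%R])
    (expR (1 * (x - a))%R)%:E)%E; last first.
    by rewrite integral_expR_affine ?mul1r.
  apply: eq_integral => x; rewrite inE/= in_itv/= => /andP[_ xv].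
  by rewrite mul1r ler0_norm ?opprK// subr_le0 (le_trans xv).
have [a1|a1] := leP a (c - r).
  exists (expR (a - (c - r)) - expR (a - (c + r))); first exact: right.
  rewrite /dist_itv max_r; last first.
    by rewrite ger0_norm; lra.
  rewrite !ger0_norm; [|lra..].
  have -> : - (c - r - a) = a - (c - r) by ring.
  have -> : - (c + r - a) = a - (c + r) by ring.
  have -> : - (c - a - r) = a - (c - r) by ring.
  ring.
have [a2|a2] := leP (c + r) a.
  exists (expR (c + r - a) - expR (c - r - a)); first exact: left.
  rewrite /dist_itv max_r; last first.
    by rewrite ler0_norm; lra.
  rewrite !ler0_norm; [|lra..].
  rewrite !opprK.
  have -> : - (- (c - a) - r) = c + r - a by ring.
  ring.
exists (2 - expR (c - r - a) - expR (a - (c + r))).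
  rewrite (@itv_bndbnd_setU _ _ (BLeft (c - r)) (BRight a) (BRight (c + r))) ?bnd_simp ?ltW//.
  rewrite ge0_integral_setU//=; [|exact: mJ|]; last first.
    rewrite disj_set2E; apply/eqP/seteqP; split => // x /= [].
    by rewrite !in_itv/= => /andP[_ xa] /andP[/(le_lt_trans xa)]; rewrite ltxx.
  rewrite integral_itv_obnd_cbnd; last exact: mJ.
  rewrite (left _ _ (lexx a) (ltW a1)) (right _ _ (lexx a) (ltW a2)).
  rewrite !subrr expR0 -EFinD.
  by congr (_%:E); ring.
rewrite /dist_itv max_l; last first.
  have [ca|ca] := leP a c; first by rewrite ger0_norm; lra.
  by rewrite ltr0_norm; lra.
rewrite ltr0_norm ?gtr0_norm; [|lra..].
rewrite oppr0 expR0 opprK.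
have -> : - (c + r - a) = a - (c + r) by ring.
ring.
Qed.

(** * Finite signed measures and integrals against charges *)

Section finite_measure_bounded.
Context d (T : measurableType d) (R : realType).
Variable mu : {finite_measure set T -> \bar R}.

Lemma finite_integrable (D : set T) (f : T -> R) (M : R) :
  measurable D -> measurable_fun setT f -> (forall x, `|f x| <= M) ->
  mu.-integrable D (EFin \o f).
Proof.
move=> mD mf fM; apply: measurable_bounded_integrable => //.
- by rewrite ltey_eq fin_num_measure.
- exact: measurable_funTS.
- exists M; split; first exact: num_real.
  by move=> M' MM' x _; apply: le_trans (ltW MM').
Qed.

Lemma Rintegral_sum (I : Type) (s : seq I) (D : set T) (f : I -> T -> R) :
  measurable D -> (forall i, mu.-integrable D (EFin \o f i)) ->
  \int[mu]_(x in D) (\sum_(i <- s) f i x) = \sum_(i <- s) \int[mu]_(x in D) f i x.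
Proof.
move=> mD intf; elim: s => [|i s IH].
  under eq_Rintegral do rewrite big_nil.
  by rewrite Rintegral_cst// mul0r big_nil.
under eq_Rintegral do rewrite big_cons.
rewrite RintegralD ?IH ?big_cons//.
apply: (@eq_integrable _ _ _ _ _ mD (fun x => \sum_(i <- s) (EFin \o f i) x)%E).
  by move=> x _; rewrite /= sumEFin.
by apply: integrable_sum => // j _; exact: intf.
Qed.

End finite_measure_bounded.

Section finite_measure_instances.
Context d (T : measurableType d) (R : realType).
Variables m1 m2 : {finite_measure set T -> \bar R}.

Let mzero_fin : fin_num_fun (@mzero d T R). Proof. by []. Qed.

HB.instance Definition _ := @Measure_isFinite.Build _ _ _ (@mzero d T R) mzero_fin.

HB.instance Definition _ := Measure.copy (measure_add m1 m2)
  (msum (fun n => if n is 0%N then m1 : {measure set T -> \bar R} else m2) 2).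

Let measure_add_fin : fin_num_fun (measure_add m1 m2).
Proof. by move=> A mA; rewrite measure_addE fin_numD !fin_num_measure. Qed.

HB.instance Definition _ :=
  @Measure_isFinite.Build _ _ _ (measure_add m1 m2) measure_add_fin.

Lemma Rintegral_measure_add (K : set T) (f : T -> R) (M : R) :
  measurable K -> measurable_fun setT f -> (forall x, `|f x| <= M) ->
  \int[measure_add m1 m2]_(x in K) f x =
  \int[m1]_(x in K) f x + \int[m2]_(x in K) f x.
Proof.
move=> mK mf fM; have i1 := finite_integrable m1 mK mf fM.
have i2 := finite_integrable m2 mK mf fM.
rewrite /Rintegral integral_measure_add// fineD//; exact: integrable_fin_num.
Qed.

Lemma Rintegral_mscale (c : {nonneg R}) (K : set T) (f : T -> R) (M : R) :
  measurable K -> measurable_fun setT f -> (forall x, 0 <= f x <= M) ->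
  \int[mscale c m1]_(x in K) f x = c%:num * \int[m1]_(x in K) f x.
Proof.
move=> mK mf fM; have f0 x : 0 <= f x by have /andP[] := fM x.
have i1 : m1.-integrable K (EFin \o f).
  by apply: (@finite_integrable _ _ _ _ _ _ M) => // x; rewrite ger0_norm//; have /andP[] := fM x.
rewrite /Rintegral ge0_integral_mscale//; last 2 first.
- by apply/measurable_EFinP; exact: measurable_funTS.
- by move=> x _; rewrite lee_fin.
by rewrite fineM//; exact: integrable_fin_num.
Qed.

End finite_measure_instances.

(** Terms with a nonnegative coefficient go to [mu] and the others to [nu]. *)
Lemma signed_combination d (T : measurableType d) (R : realType) (I : Type)
    (s : seq I) (c : I -> R) (m : I -> {finite_measure set T -> \bar R}) :
  exists mu nu : {finite_measure set T -> \bar R},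
  (forall A, measurable A ->
    fine (mu A) - fine (nu A) = \sum_(i <- s) c i * fine (m i A)) /\
  forall (K : set T) (f : T -> R) (M : R), measurable K -> measurable_fun setT f ->
    (forall x, 0 <= f x <= M) ->
    \int[mu]_(x in K) f x - \int[nu]_(x in K) f x =
    \sum_(i <- s) c i * \int[m i]_(x in K) f x.
Proof.
elim: s => [|i s [mu [nu [E1 E2]]]].
  exists (@mzero d T R), (@mzero d T R); split => [A mA|K f M mK mf fM].
    by rewrite big_nil subrr.
  by rewrite big_nil subrr.
have fM' (f : T -> R) M : (forall x, 0 <= f x <= M) -> forall x, `|f x| <= M.
  by move=> fM x; have /andP[? ?] := fM x; rewrite ger0_norm.
have [c0|c0] := leP 0 (c i).
  exists (measure_add mu (mscale (NngNum c0) (m i))), nu.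
  split => [A mA|K f M mK mf fM].
    rewrite /= measure_addE fineD ?fin_num_measure// /= /mscale fineM ?fin_num_measure//.
    by rewrite big_cons -E1//=; ring.
  rewrite (Rintegral_measure_add _ _ mK mf (fM' _ _ fM)).
  by rewrite (Rintegral_mscale _ _ mK mf fM)//= big_cons -(E2 _ _ _ mK mf fM); ring.
have c1 : 0 <= - c i by rewrite oppr_ge0 ltW.
exists mu, (measure_add nu (mscale (NngNum c1) (m i))).
split => [A mA|K f M mK mf fM].
  rewrite /= measure_addE fineD ?fin_num_measure// /= /mscale fineM ?fin_num_measure//.
  by rewrite big_cons -E1//=; ring.
rewrite (Rintegral_measure_add _ _ mK mf (fM' _ _ fM)).
by rewrite (Rintegral_mscale _ _ mK mf fM)//= big_cons -(E2 _ _ _ mK mf fM); ring.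
Qed.

Section charge_integral.
Context d (T : measurableType d) (R : realType).
Implicit Types (omega : {charge set T -> \bar R}).
Implicit Types (mu nu : {finite_measure set T -> \bar R}).

Lemma charge_of_difference mu nu : exists omega : {charge set T -> \bar R},
  forall A, measurable A -> omega A = (fine (mu A) - fine (nu A))%:E.
Proof.
exists (cadd (charge_of_finite_measure mu) (copp (charge_of_finite_measure nu))).
move=> A mA; rewrite EFinB !fineK ?fin_num_measure//.
Qed.

(** Moving the negative parts to the other side turns the two decompositions of
[omega] into an equality of positive measures. *)
Lemma charge_integralE omega mu nu K (f : T -> R) (M : R) :
  (forall A, measurable A -> omega A = (fine (mu A) - fine (nu A))%:E) ->
  measurable K -> measurable_fun setT f -> (forall x, `|f x| <= M) ->
  charge_integral omega K (EFin \o f) =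
  (\int[mu]_(x in K) f x - \int[nu]_(x in K) f x)%:E.
Proof.
move=> omE mK mf fM; rewrite /charge_integral.
set HN := projT2 (cid (projT2 (cid (Hahn_decomposition omega)))).
set jp := jordan_pos HN; set jn := jordan_neg HN.
have fin (lam : {finite_measure set T -> \bar R}) :
    (\int[lam]_(x in K) (f x)%:E)%E \is a fin_num.
  by apply: integrable_fin_num => //; exact: finite_integrable fM.
have E A : measurable A -> measure_add jp nu A = measure_add mu jn A.
  move=> mA; rewrite !measure_addE.
  change (jp A + nu A = mu A + jn A)%E.
  have e : (fine (mu A) - fine (nu A))%:E = (jp A - jn A)%E.
    by rewrite -omE// (jordan_decomp HN mA) /cadd/= cscaleN1.
  have jpA : jp A \is a fin_num by exact: fin_num_measure.
  have jnA : jn A \is a fin_num by exact: fin_num_measure.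
  move: e; rewrite -(fineK jpA) -(fineK jnA) -EFinB => -[e].
  have nuA : nu A \is a fin_num by exact: fin_num_measure.
  have muA : mu A \is a fin_num by exact: fin_num_measure.
  by rewrite -(fineK nuA) -(fineK muA) -!EFinD; congr (_%:E); lra.
have : \int[measure_add jp nu]_(x in K) f x = \int[measure_add mu jn]_(x in K) f x.
  by congr fine; apply: eq_measure_integral => A mA _; exact: E.
rewrite !(Rintegral_measure_add _ _ mK mf fM) => J.
rewrite -[X in (X - _)%E]fineK ?fin// -[X in (_ - X)%E]fineK ?fin//.
rewrite -EFinB; congr (_%:E).
apply/eqP; rewrite subr_eq addrAC eq_sym subr_eq eq_sym; exact/eqP.
Qed.

Lemma jordan_difference omega : exists mu nu, forall A, measurable A ->
  omega A = (fine (mu A) - fine (nu A))%:E.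
Proof.
have [P [Q PQ]] := Hahn_decomposition omega.
exists (jordan_pos PQ), (jordan_neg PQ) => A mA.
rewrite (jordan_decomp PQ mA) /cadd/= cscaleN1 EFinB.
by rewrite !fineK// fin_num_measure.
Qed.

End charge_integral.

(** * Discretization of finite measures *)

Section d1_theory.
Context (R : realType) (N : nat).
Implicit Types x y z a : N.-tuple R.

Lemma measurable_d1 a : measurable_fun setT (fun x => d1 x a).
Proof.
apply: measurable_sum => k; apply: measurableT_comp => //.
by apply: measurable_funB => //; exact: measurable_tnth.
Qed.

Lemma measurable_expR_d1 a : measurable_fun setT (fun x => expR (- d1 x a)).
Proof.
by apply: measurableT_comp => //; apply: measurableT_comp => //; exact: measurable_d1.
Qed.

Definition potential (mu : {measure set (N.-tuple R) -> \bar R}) (K : set (N.-tuple R)) a : R :=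
  \int[mu]_(x in K) expR (- d1 x a).

Definition d1_net (K : set (N.-tuple R)) (delta : R) n (q : 'I_n -> N.-tuple R) :=
  (forall i, K (q i)) /\ (forall x, K x -> exists i, d1 x (q i) <= delta).

Definition d1_totally_bounded (K : set (N.-tuple R)) :=
  forall delta, 0 < delta -> exists n (q : 'I_n -> N.-tuple R), d1_net K delta q.

(** The mass of [mu] is moved from each point of [K] to the first point of the net
that is within [delta]; the kernel changes by at most [delta] because it is
1-Lipschitz. *)
Lemma discretize (mu : {finite_measure set (N.-tuple R) -> \bar R}) K delta n
    (q : 'I_n -> N.-tuple R) :
  measurable K -> 0 <= delta -> d1_net K delta q ->
  exists2 v : 'I_n -> R, (forall i, 0 <= v i) /\ \sum_i v i = fine (mu K) &
    forall a, `|\sum_i v i * expR (- d1 (q i) a) - potential mu K a| <=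
              delta * fine (mu K).
Proof.
move=> mK d0 [qK qnet].
(* Cell of [i]: the points of [K] for which [q i] is the first close net point. *)
pose A i := K `&` ([set x | d1 x (q i) <= delta] `\`
  \bigcup_(j in [set j : 'I_n | (j < i)%N]) [set x | d1 x (q j) <= delta]).
have mball i : measurable [set x | d1 x (q i) <= delta].
  rewrite (_ : [set x | _] = setT `&` (fun x => d1 x (q i)) @^-1` [set` `]-oo, delta]]).
    by apply: measurable_d1.
  by rewrite setTI; apply/seteqP; split => x /=; rewrite in_itv.
have mA i : measurable (A i).
  apply: measurableI => //; apply: measurableD => //.
  by apply: fin_bigcup_measurable => //; exact: finite_finset.
have Aq i x : A i x -> d1 x (q i) <= delta by case=> _ [].
have AK x : K x -> exists2 i, A i x & forall j, A j x -> j = i.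
  move=> Kx; have [i0 i0P] := qnet x Kx.
  case: (@arg_minnP _ i0 (fun i => d1 x (q i) <= delta) (@nat_of_ord n) i0P) => i iP imin.
  have Ai : A i x.
    by split=> //; split=> //; move=> [j /= ji] /imin; rewrite leqNgt ji.
  exists i => // j Aj; apply/val_inj/eqP; rewrite eqn_leq imin ?andbT; last exact: Aq.
  rewrite leqNgt; apply/negP => ij; case: Aj => _ [_]; apply.
  by exists i.
pose s (g : 'I_n -> R) x := \sum_i \1_(A i) x * g i.
have ms g : measurable_fun setT (s g).
  apply: measurable_sum => i; apply: measurable_funM => //.
have sE g x : K x -> exists2 i, d1 x (q i) <= delta & s g x = g i.
  move=> Kx; have [i Ai iu] := AK x Kx; exists i; first exact: Aq.
  rewrite /s (bigD1 i)//= indicE mem_set// mul1r big1 ?addr0// => j ji.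
  rewrite indicE memNset ?mul0r// => /iu ji'; by rewrite ji' eqxx in ji.
have iA g i : mu.-integrable K (EFin \o (fun x => \1_(A i) x * g i)).
  apply: (@finite_integrable _ _ _ _ _ _ `|g i|) => //.
    exact: measurable_funM.
  move=> x; rewrite normrM ler_piMl// indicE ger0_norm// lern1.
  by case: (_ \in _).
have int_s g : \int[mu]_(x in K) s g x = \sum_i fine (mu (A i)) * g i.
  rewrite Rintegral_sum//; apply: eq_bigr => i _.
  rewrite RintegralZr//; last first.
    apply: (@finite_integrable _ _ _ _ _ _ 1) => // x.
    by rewrite indicE ger0_norm// lern1; case: (_ \in _).
  by rewrite /Rintegral integral_indic// setIidl// => x [].
exists (fun i => fine (mu (A i))).
  split; first by move=> i; rewrite fine_ge0.
  transitivity (\int[mu]_(x in K) s (fun=> 1) x).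
    by rewrite int_s; apply: eq_bigr => i _; rewrite mulr1.
  rewrite -[RHS]mul1r -Rintegral_cst//; apply: eq_Rintegral => x.
  by rewrite inE => /(sE (fun=> 1))[].
have isg g : mu.-integrable K (EFin \o s g).
  apply: (@finite_integrable _ _ _ _ _ _ (\sum_i `|g i|)) => // x.
  rewrite (le_trans (ler_norm_sum _ _ _))//; apply: ler_sum => i _.
  rewrite normrM ler_piMl// indicE ger0_norm// lern1; by case: (_ \in _).
move=> a.
have ie : mu.-integrable K (EFin \o (fun x => expR (- d1 x a))).
  apply: (@finite_integrable _ _ _ _ _ _ 1) => //; first exact: measurable_expR_d1.
  by move=> x; exact: norm_expR_d1.
pose g i := expR (- d1 (q i) a).
rewrite -(int_s g) /potential -RintegralB//.
have isB : mu.-integrable K (EFin \o (fun x => s g x - expR (- d1 x a))).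
  exact: integrableB (isg g) ie.
rewrite (le_trans (le_normr_Rintegral _ _))// -Rintegral_cst//.
apply: le_Rintegral => //.
- exact: integrable_norm isB.
- exact: (@finite_integrable _ _ _ _ _ _ `|delta|).
- move=> x /(sE g)[i xi ->]; rewrite (le_trans (expR_d1_lipschitz _ _ _))//.
  by rewrite d1C.
Qed.

Lemma discretize_signed (mu nu : {finite_measure set (N.-tuple R) -> \bar R})
    K delta n (q : 'I_n -> N.-tuple R) :
  measurable K -> 0 <= delta -> d1_net K delta q ->
  let C := fine (mu K) + fine (nu K) in
  exists v : 'I_n -> R,
  [/\ \sum_i v i = fine (mu K) - fine (nu K), \sum_i `|v i| <= C &
      forall a, `|\sum_i v i * expR (- d1 (q i) a) -
                 (potential mu K a - potential nu K a)| <= delta * C].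
Proof.
move=> mK d0 qnet C.
have [v1 [v10 v1K] v1a] := discretize mu mK d0 qnet.
have [v2 [v20 v2K] v2a] := discretize nu mK d0 qnet.
exists (fun i => v1 i - v2 i); split.
- by rewrite sumrB v1K v2K.
- rewrite /C -v1K -v2K -big_split/=; apply: ler_sum => i _.
  by rewrite (le_trans (ler_normB _ _))// !ger0_norm.
- move=> a; under eq_bigr do rewrite mulrBl; rewrite sumrB.
  have := v1a a; have := v2a a.
  rewrite /C mulrDr; set S1 := \sum_i _; set S2 := \sum_i _ => h2 h1.
  rewrite (_ : S2 - S1 - _ = (S2 - potential mu K a) - (S1 - potential nu K a)); last by ring.
  by rewrite (le_trans (ler_normB _ _))// lerD.
Qed.

(** The energy of [v] is the integral of its potential against [v] itself. *)
Lemma energy_le n (q : 'I_n -> N.-tuple R) (v : 'I_n -> R) (kappa C e : R) :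
  0 <= e -> \sum_i `|v i| <= C ->
  (forall j, `|\sum_i v i * expR (- d1 (q i) (q j)) - kappa| <= e) ->
  \sum_i \sum_j v i * v j * expR (- d1 (q i) (q j)) <=
    kappa * (\sum_i v i) + e * C.
Proof.
move=> e0 vC vk.
have -> : \sum_i \sum_j v i * v j * expR (- d1 (q i) (q j)) =
    \sum_j v j * (\sum_i v i * expR (- d1 (q i) (q j))).
  rewrite exchange_big; apply: eq_bigr => j _; rewrite mulr_sumr.
  by apply: eq_bigr => i _; ring.
apply: (@le_trans _ _ (\sum_j (kappa * v j + e * `|v j|))); last first.
  by rewrite big_split/= -!mulr_sumr lerD2l ler_wpM2l.
apply: ler_sum => j _; rewrite -lerBlDl [kappa * _]mulrC -mulrBr.
by rewrite (le_trans (ler_norm _))// normrM mulrC ler_wpM2r.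
Qed.

(** Let U be the difference of the two potentials at [a].  The family made of the
discretized difference of [mu] and [nu] and of a point mass [s] at [a] has
energy close to s^2 + 2 s U, because the discretized difference has almost no
energy.  At s = - U this is - U^2, so semidefiniteness forces U = 0. *)
Theorem potential_eq0 (mu nu : {finite_measure set (N.-tuple R) -> \bar R}) K :
  measurable K -> d1_totally_bounded K ->
  (forall a, K a -> potential mu K a = potential nu K a) ->
  forall a, potential mu K a = potential nu K a.
Proof.
move=> mK tbK munu a.
pose C := fine (mu K) + fine (nu K).
have C0 : 0 <= C by rewrite addr_ge0// fine_ge0.
set U := potential mu K a - potential nu K a.
have H (s delta : R) : 0 < delta ->
    0 <= s ^+ 2 + 2 * s * U + 2 * `|s| * (delta * C) + delta * C * C.
  move=> d0; have [n [q qnet]] := tbK _ d0.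
  have [v [vV vC va]] := discretize_signed mu nu mK (ltW d0) qnet.
  have vv := @energy_le n q v 0 C (delta * C).
  have {}vv : \sum_i \sum_j v i * v j * expR (- d1 (q i) (q j)) <= delta * C * C.
    rewrite (le_trans (vv _ _ _)) ?mul0r ?add0r//.
      by rewrite mulr_ge0// ltW.
    move=> j; have := va (q j); rewrite munu ?subrr//; exact: (proj1 qnet).
  have := d1_psd_sub (fun _ : 'I_1 => a) q (fun=> - s) v.
  rewrite !big_ord1 d1xx oppr0 expR0 mulr1.
  have -> : \sum_j - s * v j * expR (- d1 a (q j)) =
    - s * (\sum_j v j * expR (- d1 (q j) a)).
    by rewrite mulr_sumr; apply: eq_bigr => j _; rewrite d1C mulrA.
  have := va a; rewrite -/U -/C; set S := \sum_i v i * _ => SU sS.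
  have : s * (S - U) <= `|s| * (delta * C).
    by rewrite (le_trans (ler_norm _))// normrM ler_wpM2l.
  lra.
have {}H : 0 <= - U ^+ 2.
  rewrite -oppr_le0 opprK; apply/ler_addgt0Pr => e e0; rewrite add0r.
  (* The added 1 makes [M] positive when [C] is 0. *)
pose M := 2 * `|U| * C + C * C + 1.
  have M0 : 0 < M by rewrite ltr_wpDl// addr_ge0// ?mulr_ge0//.
  have := H (- U) (e / M) (divr_gt0 e0 M0); rewrite normrN.
  have : 2 * `|U| * (e / M * C) + e / M * C * C = e / M * (M - 1).
    by rewrite /M; ring.
  have : e / M * (M - 1) <= e.
    rewrite mulrBr divfK ?gt_eqF// lerBlDr lerDl mulr1; exact/ltW/divr_gt0.
  lra.
move: H; rewrite oppr_ge0 => U0; apply/eqP; rewrite -subr_eq0 -/U -sqrf_eq0.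
by rewrite eq_le U0 sqr_ge0.
Qed.

End d1_theory.

(** * Magnitude as the mass of a weight measure *)

(** The weighting exists, so the choice operator in [mag_fin] returns one. *)
Lemma mag_finE (R : realType) (N : nat) (G : {fset N.-tuple R}) :
  exists2 w : G -> R, weighting w & mag_fin G = \sum_p w p.
Proof.
have [w0 w0E _] := @d1_system_unique R N G val val_inj (fun=> 1).
exists (xget (fun=> 0) (@weighting R N G)) => //.
apply: (@xgetPex _ (fun=> 0) (@weighting R N G)); exists w0 => p.
by rewrite -[RHS](w0E p); apply: eq_bigr => q _; rewrite d1C mulrC.
Qed.

Lemma weighting_energy (R : realType) (N : nat) (G : {fset N.-tuple R})
    (w : G -> R) : weighting w ->
  \sum_p \sum_q w p * w q * expR (- d1 (val p) (val q)) = \sum_p w p.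
Proof.
move=> wP; apply: eq_bigr => p _; rewrite -[RHS]mulr1 -(wP p) mulr_sumr.
by apply: eq_bigr => q _; ring.
Qed.

(** Let [v] be a discretization with nearly constant potential 1, whose energy is
then nearly its mass V, and let [w] be the weighting of a finite subset G of
[K].  The energy of [w] is mag G, and the mutual energy of [v] and [w] is nearly
mag G, because [v] has potential 1 on G; hence 2 mag G <= mag G + V
approximately.  If G is the net that carries [v], then the mutual energy is V, because
[w] has potential 1 on G; hence 2 V <= mag G + V approximately. *)
Theorem mag_weight (R : realType) (N : nat)
    (mu nu : {finite_measure set (N.-tuple R) -> \bar R}) (K : set (N.-tuple R)) :
  measurable K -> d1_totally_bounded K ->
  (forall a, K a -> potential mu K a - potential nu K a = 1) ->
  mag K = (fine (mu K) - fine (nu K))%:E.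
Proof.
move=> mK tbK munu; set V := fine (mu K) - fine (nu K).
pose C := fine (mu K) + fine (nu K).
have C0 : 0 <= C by rewrite addr_ge0// fine_ge0.
have H (delta : R) : 0 < delta -> exists n (q : 'I_n -> N.-tuple R)
    (v : 'I_n -> R), [/\ forall i, K (q i), \sum_i v i = V,
    forall a, K a -> `|\sum_i v i * expR (- d1 (q i) a) - 1| <= delta * C &
    \sum_i \sum_j v i * v j * expR (- d1 (q i) (q j)) <= V + delta * C * C].
  move=> d0; have [n [q qnet]] := tbK _ d0.
  have [v [vV vC va]] := discretize_signed mu nu mK (ltW d0) qnet.
  rewrite -/V in vV; exists n, q, v; split => //; first exact: (proj1 qnet).
    by move=> a Ka; rewrite -(munu _ Ka).
  rewrite -[V]mul1r -vV; apply: energy_le => //.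
    by rewrite mulr_ge0// ltW.
  by move=> j; rewrite -(munu (q j))//; exact: (proj1 qnet).
have small (x M : R) : 0 <= M -> (forall delta : R, 0 < delta -> x <= delta * M) -> x <= 0.
  move=> M0 xM; apply/ler_addgt0Pr => e e0; rewrite add0r.
  have M1 : 0 < M + 1 by rewrite ltr_wpDl.
  rewrite (le_trans (xM _ (divr_gt0 e0 M1)))//.
  by rewrite -mulrA ler_piMr ?(ltW e0)// mulrC ler_pdivrMr// mul1r lerDl.
apply/eqP; rewrite eq_le; apply/andP; split.
  apply: ub_ereal_sup => _ [G GK <-]; rewrite lee_fin -subr_le0.
  have [w wP ->] := mag_finE G.
  pose W := \sum_p `|w p|.
  have W0 : 0 <= W by exact: sumr_ge0.
  apply: (small _ (2 * W * C + C * C)) => [|delta d0].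
    by rewrite addr_ge0// ?mulr_ge0.
  have [n [q [v [qK vV va vv]]]] := H _ d0.
  have := d1_psd_sub (val : G -> _) q w v; rewrite weighting_energy//.
  have : \sum_p w p - W * (delta * C) <=
      \sum_p \sum_j w p * v j * expR (- d1 (val p) (q j)).
    rewrite mulr_suml -sumrB; apply: ler_sum => p _.
    rewrite (_ : \sum_j _ = w p * \sum_j v j * expR (- d1 (q j) (val p))); last first.
      by rewrite mulr_sumr; apply: eq_bigr => j _; rewrite d1C mulrA.
    have := va _ (GK _ (valP p)); set S := \sum_j _ => Sp.
    have : w p * (1 - S) <= `|w p| * (delta * C).
      by rewrite (le_trans (ler_norm _))// normrM ler_wpM2l// distrC.
    lra.
  lra.
apply/lee_addgt0Pr => e e0.
have M0 : 0 < C * C + 1 by rewrite ltr_wpDl// mulr_ge0.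
have [n [q [v [qK vV va vv]]]] := H _ (divr_gt0 e0 M0).
pose G := [fset q i | i in 'I_n]%fset.
apply: (@le_trans _ _ ((mag_fin G)%:E + e%:E)%E); last first.
  rewrite leeD2r//; apply: ereal_sup_ubound; exists G => //.
  by move=> _ /= /imfsetP[i _ ->].
have [w wP ->] := mag_finE G.
have := d1_psd_sub (val : G -> _) q w v; rewrite weighting_energy//.
have -> : \sum_p \sum_j w p * v j * expR (- d1 (val p) (q j)) = V.
  rewrite exchange_big -vV; apply: eq_bigr => j _.
  have qG : q j \in G by apply/imfsetP; exists j.
  rewrite -[RHS]mulr1 -(wP [` qG]%fset) mulr_sumr; apply: eq_bigr => p _.
  by rewrite d1C /=; ring.
rewrite -EFinD lee_fin.
have : e / (C * C + 1) * C * C <= e.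
  by rewrite -mulrA -mulrAC ler_pdivrMr// ler_wpM2l ?(ltW e0)// lerDl.
lra.
Qed.

(** * From exponential kernels to indicators of orthants *)

(** The one-sided exponential: the building block between the kernel e^(-|x-a|)
and the indicator functions of half-lines. *)
Definition expR_tail (R : realType) (c x : R) : R := expR (c - x) * (c <= x)%R%:R.

Section one_dim_approx.
Context (R : realType).
Implicit Types a c x h : R.

(** The combination of the kernels at [a] and [a] - [h] for which the exponentials
cancel to the left of [a] - [h]; the denominator normalizes it to the right of
[a]. *)
Lemma expR_tail_approx a h x : 0 < h ->
  let f := (expR (- `|x - a|) - expR (- h) * expR (- `|x - (a - h)|)) /
           (1 - expR (- (h *+ 2))) in
  [/\ `|f| <= 1, (a <= x -> f = expR_tail a x) & (x <= a - h -> f = expR_tail a x)].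
Proof.
move=> h0 f.
have h2 : 0 < 1 - expR (- (h *+ 2)).
  by rewrite subr_gt0 -[ltRHS]expR0 ltr_expR oppr_lt0 pmulrn_lgt0.
have right : a <= x -> f = expR (a - x).
  move=> ax; rewrite /f !ger0_norm; [|lra..].
  rewrite -expRD; have -> : - h + - (x - (a - h)) = (a - x) + - (h *+ 2).
    by rewrite mulr2n; ring.
  rewrite opprB expRD -[X in X - _]mulr1 -mulrBr mulfK// gt_eqF//.
have left : x <= a - h -> f = 0.
  move=> xa; rewrite /f !ler0_norm; [|lra..].
  rewrite -expRD (_ : - h + _ = - - (x - a)) ?subrr ?mul0r//; ring.
split.
- have [ax|xa] := leP a x.
    by rewrite right// ger0_norm ?expR_ge0// -expR0 ler_expR subr_le0.
  have [/left ->|xah] := leP x (a - h); first by rewrite normr0.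
  have e1 : `|x - a| = a - x by rewrite ltr0_norm ?opprB// subr_lt0.
  have e2 : `|x - (a - h)| = x - (a - h) by rewrite ger0_norm// subr_ge0 ltW.
  (* Between [a] - [h] and [a] the numerator increases from 0 to the denominator. *)
  rewrite /f e1 e2 -expRD opprB (_ : - h + _ = - (h *+ 2) - (x - a)); last by rewrite mulr2n; ring.
  have u1 : expR (x - a) <= 1 by rewrite -expR0 ler_expR; lra.
  have u2 : expR (- (h *+ 2)) <= expR (- (h *+ 2) - (x - a)) by rewrite ler_expR; lra.
  have u3 : expR (- (h *+ 2) - (x - a)) <= expR (x - a).
    by rewrite ler_expR mulr2n; lra.
  rewrite normrM normfV (gtr0_norm h2) ler_pdivrMr// mul1r ger0_norm; lra.
- by move=> ax; rewrite /expR_tail ax mulr1 right.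
- move=> xa; rewrite /expR_tail left// leNgt (le_lt_trans xa) ?mulr0//.
  by rewrite gtrBl.
Qed.

Lemma expR_tail_window c h x : 0 < h ->
  expR (- h) * (c <= x < c + h)%R%:R <=
    expR_tail c x - expR (- h) * expR_tail (c + h) x <= (c <= x < c + h)%R%:R.
Proof.
move=> h0; rewrite /expR_tail.
have [cx|xc] := leP c x; last first.
  by rewrite [c + h <= x]leNgt (lt_trans xc) ?ltrDl//= !mulr0 subrr lexx.
have [xch|chx] := ltP x (c + h) => /=.
  rewrite !mulr0 subr0 !mulr1 ler_expR -expR0 ler_expR.
  by apply/andP; split; lra.
rewrite !mulr1 mulr0 -expRD.
by rewrite (_ : - h + _ = c - x) ?subrr ?lexx//; ring.
Qed.

(** Consecutive one-sided exponentials differ by an exponential on a window of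
width [h], where it stays between e^(-h) and 1; the windows tile the half-line. *)
Lemma expR_tail_mesh a h x m : 0 < h ->
  expR (- h) * (a <= x < a + m%:R * h)%R%:R <=
    \sum_(i < m) (expR_tail (a + i%:R * h) x -
                  expR (- h) * expR_tail (a + i.+1%:R * h) x) <=
    (a <= x < a + m%:R * h)%R%:R.
Proof.
move=> h0; elim: m => [|m IH] /=.
  rewrite big_ord0 mul0r addr0.
  have -> : (a <= x < a) = false by apply/negbTE/negP => /andP[]; lra.
  by rewrite mulr0 lexx.
rewrite big_ord_recr/=; set S := \sum_(i < m) _ in IH *.
have := expR_tail_window (a + m%:R * h) x h0.
rewrite -[_ + _ + h]addrA -[X in _ + (_ + X)]mul1r -mulrDl natr1; set g := _ - _.
have amh : a <= a + m%:R * h by rewrite lerDl mulr_ge0// ltW.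
have amh1 : a + m%:R * h <= a + m.+1%:R * h.
  by rewrite lerD2l ler_wpM2r ?(ltW h0)// ler_nat.
have <- : (a <= x < a + m%:R * h)%R%:R + (a + m%:R * h <= x < a + m.+1%:R * h)%R%:R
    = (a <= x < a + m.+1%:R * h)%R%:R :> R.
  have [xm|mx] := ltP x (a + m%:R * h).
    by rewrite (lt_le_trans xm amh1) andbT addr0.
  by rewrite (le_trans amh mx) add0r.
by move: IH => /andP[? ?] /andP[? ?]; rewrite mulrDr !lerD.
Qed.

End one_dim_approx.

Section same_integral.
Context d (T : measurableType d) (R : realType).
Variables (mu nu : {finite_measure set T -> \bar R}) (K : set T).
Hypothesis mK : measurable K.
Implicit Types (f g : T -> R) (xi : T -> R).

(** Measurability and boundedness are included so that the class is closed under
linear combinations and bounded limits without side conditions. *)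
Definition same_integral f :=
  [/\ measurable_fun setT f, exists M : R, forall x, `|f x| <= M &
      \int[mu]_(x in K) f x = \int[nu]_(x in K) f x].

Let same_integrable (lam : {finite_measure set T -> \bar R}) f :
  same_integral f -> lam.-integrable K (EFin \o f).
Proof. by case=> mf [M fM] _; exact: finite_integrable fM. Qed.

Lemma same_integralD f g : same_integral f -> same_integral g ->
  same_integral (fun x => f x + g x).
Proof.
move=> sf sg; have [mf [M fM] fE] := sf; have [mg [M' gM] gE] := sg; split.
- exact: measurable_funD.
- by exists (M + M') => x; rewrite (le_trans (ler_normD _ _))// lerD.
- by rewrite !RintegralD ?fE ?gE//; exact: same_integrable.
Qed.

Lemma same_integralZ (c : R) f : same_integral f -> same_integral (fun x => c * f x).
Proof.
move=> sf; have [mf [M fM] fE] := sf; split.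
- exact: measurable_funM.
- by exists (`|c| * M) => x; rewrite normrM ler_wpM2l.
- by rewrite !RintegralZl ?fE//; exact: same_integrable.
Qed.

Lemma same_integral_sum n (f : nat -> T -> R) : (forall i, same_integral (f i)) ->
  same_integral (fun x => \sum_(i < n) f i x).
Proof.
move=> sf; elim: n => [|n IH].
  rewrite (_ : (fun _ => _) = fun x => 0 * f 0%N x); first exact: same_integralZ.
  by apply/funext => x; rewrite big_ord0 mul0r.
rewrite (_ : (fun _ => _) = fun x => \sum_(i < n) f i x + f n x).
  exact: same_integralD.
by apply/funext => x; rewrite big_ord_recr.
Qed.

(** Dominated convergence for both measures and uniqueness of the limit. *)
Lemma same_integral_lim (f_ : nat -> T -> R) f (M : R) :
  (forall n, same_integral (f_ n)) -> (forall n x, `|f_ n x| <= M) ->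
  (forall x, f_ ^~ x @ \oo --> f x) -> same_integral f.
Proof.
move=> sf fM ff.
have mf : measurable_fun setT f.
  apply: (@measurable_fun_cvg _ _ _ _ f_) => [n|x _]; last exact: ff.
  by have [] := sf n.
have ub x : `|f x| <= M.
  have h : (fun n => `|f_ n x|) @ \oo --> `|f x| by apply: cvg_norm; exact: ff.
  rewrite -(cvg_lim _ h)//; apply: limr_le; first by apply/cvg_ex; exists `|f x|.
  by apply: nearW => n; exact: fM.
split => //; first by exists M.
have lim (lam : {finite_measure set T -> \bar R}) :
    (fun n => \int[lam]_(x in K) (f_ n x)%:E)%E @ \oo -->
    (\int[lam]_(x in K) (f x)%:E)%E.
  have [|||||//] := @dominated_convergence _ _ _ lam K mK
     (fun n => EFin \o f_ n) (EFin \o f) (cst M%:E).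
  - by move=> n; apply/measurable_EFinP; apply: measurable_funTS; have [] := sf n.
  - by apply/measurable_EFinP; exact: measurable_funTS.
  - by apply: aeW => x _; apply: cvg_EFin; [exact: nearW|exact: ff].
  - exact: (@finite_integrable _ _ _ lam K (cst M) `|M|).
  - by apply: aeW => x n _; rewrite /= lee_fin.
have E n : (\int[mu]_(x in K) (f_ n x)%:E = \int[nu]_(x in K) (f_ n x)%:E)%E.
  have [_ _ fE] := sf n.
  have fin (lam : {finite_measure set T -> \bar R}) :
      (\int[lam]_(x in K) (f_ n x)%:E)%E \is a fin_num.
    by apply: integrable_fin_num => //; exact: same_integrable.
  by rewrite -[LHS]fineK// -[RHS]fineK//; congr (_%:E).
rewrite /Rintegral; congr fine.
have lmu := lim mu; rewrite (funext E) in lmu.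
exact: (cvg_unique _ lmu (lim nu)).
Qed.

Section coordinate.
Variables (H xi : T -> R).
Hypothesis HM : exists M : R, forall x, `|H x| <= M.
Hypothesis Hexp : forall a, same_integral (fun x => H x * expR (- `|xi x - a|)).

Let same_integral_tail a : same_integral (fun x => H x * expR_tail a (xi x)).
Proof.
have [M HMx] := HM.
pose h n : R := n.+1%:R^-1.
have h0 n : 0 < h n by rewrite invr_gt0.
pose f n x := (expR (- `|x - a|) - expR (- h n) * expR (- `|x - (a - h n)|)) /
           (1 - expR (- (h n *+ 2))).
apply: (@same_integral_lim (fun n x => H x * f n (xi x)) _ M).
- move=> n; pose C := (1 - expR (- (h n *+ 2)))^-1.
  rewrite (_ : (fun x => _) = fun x => C * (H x * expR (- `|xi x - a|)) +
     (- (C * expR (- h n))) * (H x * expR (- `|xi x - (a - h n)|))).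
    by apply: same_integralD; exact: same_integralZ.
  by apply/funext => x; rewrite /f /C; ring.
- move=> n x; rewrite normrM; have [f1 _ _] := @expR_tail_approx R a (h n) (xi x) (h0 n).
  by rewrite -[leRHS]mulr1 ler_pM.
- move=> x; have [ax|xa] := leP a (xi x).
    apply: cvg_near_cst; apply: nearW => n.
    by have [_ /(_ ax) E _] := @expR_tail_approx R a (h n) (xi x) (h0 n); rewrite -E.
  apply: cvg_near_cst.
  have ax0 : 0 < a - xi x by rewrite subr_gt0.
  near=> n.
  have [_ _ E] := @expR_tail_approx R a (h n) (xi x) (h0 n); rewrite -E//.
  rewrite lerBrDr -lerBrDl; apply/ltW; near: n.
  exact: (near_infty_natSinv_lt (PosNum ax0)).
Unshelve. all: by end_near.
Qed.

(** One coordinate [xi] at a time: the factor [H] collects the other coordinates.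
Two passages to the limit lead from the kernel to the one-sided exponential and
from there to the indicator function. *)
Lemma same_integral_ge a : same_integral (fun x => H x * (a <= xi x)%R%:R).
Proof.
have [M HMx] := HM.
pose h n : R := n.+1%:R^-1.
have h0 n : 0 < h n by rewrite invr_gt0.
(* With a mesh of width 1/(n+1), these windows cover a length of n+1. *)
pose m n : nat := (n.+1 * n.+1)%N.
have mh n : (m n)%:R * h n = n.+1%:R.
  by rewrite /m /h natrM mulfK.
pose s n x := \sum_(i < m n) (expR_tail (a + i%:R * h n) x -
                  expR (- h n) * expR_tail (a + i.+1%:R * h n) x).
apply: (@same_integral_lim (fun n x => H x * s n (xi x)) _ M).
- move=> n; rewrite (_ : (fun x => _) = fun x => \sum_(i < m n)
     (H x * expR_tail (a + i%:R * h n) (xi x) +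
      - expR (- h n) * (H x * expR_tail (a + i.+1%:R * h n) (xi x)))).
    apply: (@same_integral_sum _ (fun i x =>
      H x * expR_tail (a + i%:R * h n) (xi x) +
      - expR (- h n) * (H x * expR_tail (a + i.+1%:R * h n) (xi x)))) => i.
    apply: same_integralD; first exact: same_integral_tail.
    exact/same_integralZ/same_integral_tail.
  apply/funext => x; rewrite mulr_sumr; apply: eq_bigr => i _; ring.
- move=> n x; rewrite normrM -[leRHS]mulr1 ler_pM//.
  have /andP[s0 s1] := expR_tail_mesh a (xi x) (m n) (h0 n).
  rewrite ger0_norm.
    by rewrite (le_trans s1)// lern1; case: (_ && _).
  by rewrite (le_trans _ s0)// mulr_ge0 ?expR_ge0.
- move=> x; apply: cvgMr.
  have [ax|xa] := leP a (xi x); last first.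
    apply: cvg_near_cst; apply: nearW => n.
    have := expR_tail_mesh a (xi x) (m n) (h0 n).
    rewrite [a <= xi x]leNgt xa/= mulr0 => s0; apply/eqP.
    by rewrite eq_le andbC.
  apply: (@squeeze_cvgr _ _ _ _ (fun n => expR (- h n)) (cst 1)); last 2 first.
  + rewrite -[X in _ --> X]expR0 -oppr0.
    apply: continuous_cvg; first exact: continuous_expR.
    apply: cvgN; exact: cvg_harmonic.
  + exact: cvg_cst.
  near=> n.
  have := expR_tail_mesh a (xi x) (m n) (h0 n); rewrite ax mh (_ : xi x < _) ?mulr1//.
  rewrite -ltrBlDl; apply: (@lt_trans _ _ n%:R); last by rewrite ltr_nat.
  near: n; exact: nbhs_infty_gtr.
Unshelve. all: by end_near.
Qed.

End coordinate.
End same_integral.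

(** * A finite measure is determined by its potential *)

Section orthant.
Context (R : realType) (N : nat).
Implicit Types a : 'I_N -> R.

Definition orthant a : set (N.-tuple R) := [set x | forall k, a k <= tnth x k].

Lemma measurable_orthant a : measurable (orthant a).
Proof.
apply: (@measurable_box _ _ (fun k => [set y | a k <= y])) => k.
by rewrite -set_itvcy.
Qed.

Lemma orthantI a b :
  orthant a `&` orthant b = orthant (fun k => Num.max (a k) (b k)).
Proof.
apply/seteqP; split => x /=; first by move=> [ax bx] k; rewrite ge_max ax bx.
by move=> abx; split=> k; have := abx k; rewrite ge_max => /andP[].
Qed.

Lemma bigcup_orthant (P : pred 'I_N) a :
  \bigcup_n orthant (fun k => if P k then a k else - n%:R) =
  [set x | forall k, P k -> a k <= tnth x k].
Proof.
apply/seteqP; split => x /= => [[n _ nx] k Pk|ax].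
  by have := nx k; rewrite Pk.
pose n := (\max_k (Num.truncn `|tnth x k|).+1)%N.
exists n => // k; case: ifPn => [/ax//|_].
rewrite lerNl (le_trans (ler_norm _))// normrN.
apply/ltW/(lt_le_trans (truncnS_gt _)).
by rewrite ler_nat /n (leq_bigmax k).
Qed.

(** A half-space given by one coordinate is a countable union of orthants. *)
Lemma orthant_generate : (@measurable _ (N.-tuple R)) =
  <<s [set O | exists a, O = orthant a] >>.
Proof.
set G := [set O | _].
apply/seteqP; split; last first.
  apply: smallest_sub; first exact: sigma_algebra_measurable.
  by move=> _ [a ->]; exact: measurable_orthant.
apply: smallest_sub; first exact: smallest_sigma_algebra.
rewrite -bigcup_seq => _ [k _ [B mB <-]].
suff : <<s @RGenCInfty.G R >> `<=` image_set_system setT ((@tnth N R)^~ k) <<s G >>.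
  by apply; rewrite -[X in X B]RGenCInfty.measurableE.
apply: smallest_sub.
  exact/sigma_algebra_image/smallest_sigma_algebra.
move=> _ [x ->]; rewrite /image_set_system /= setTI.
rewrite (_ : _ @^-1` _ =
    \bigcup_n orthant (fun i => if i == k then x else - n%:R)).
  by apply: sigma_algebra_bigcup => n; apply: sub_sigma_algebra; eexists.
rewrite (bigcup_orthant (pred1 k) (fun=> x)); apply/seteqP; split => y /=.
  by rewrite in_itv/= andbT => xy _ /eqP ->.
by move=> /(_ k); rewrite eqxx in_itv/= andbT; exact.
Qed.

Variables (mu nu : {finite_measure set (N.-tuple R) -> \bar R}).
Variable K : set (N.-tuple R).
Hypothesis mK : measurable K.
Hypothesis munu : forall y, potential mu K y = potential nu K y.

Let same_integral_orthant (j : nat) a : (j <= N)%N ->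
  same_integral mu nu K (fun x => \prod_(k < N)
    if (k < j)%N then (a k <= tnth x k)%R%:R else expR (- `|tnth x k - a k|)).
Proof.
elim: j a => [|j IH] a jN.
  rewrite (_ : (fun _ => _) = fun x => expR (- d1 x [tuple a k | k < N])).
    split; [exact: measurable_expR_d1| |exact: munu].
    by exists 1 => x; exact: norm_expR_d1.
  apply/funext => x; rewrite expR_d1; apply: eq_bigr => k _.
  by rewrite tnth_mktuple.
(* Coordinate [j] is the next one whose kernel is replaced. *)
pose k0 := Ordinal jN.
pose H x := \prod_(k < N | k != k0)
    if (k < j)%N then (a k <= tnth x k)%R%:R else expR (- `|tnth x k - a k|).
rewrite (_ : (fun _ => _) = fun x => H x * (a k0 <= tnth x k0)%R%:R); last first.
  apply/funext => x; rewrite (bigD1 k0)//= ltnSn mulrC; congr (_ * _).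
  apply: eq_bigr => k kk0; rewrite ltnS leq_eqVlt.
  by have /negbTE -> : (k : nat) != j by [].
apply: same_integral_ge => //.
  exists 1 => x; rewrite normr_prod; apply: prodr_ile1 => k _; rewrite normr_ge0/=.
  case: ifP => _; first by rewrite ger0_norm// lern1; case: (_ <= _).
  by rewrite ger0_norm ?expR_ge0// -expR0 ler_expR oppr_le0.
move=> b; have := IH (fun k => if k == k0 then b else a k) (ltnW jN).
rewrite [X in same_integral _ _ _ X -> _](_ : _ =
  fun x => H x * expR (- `|tnth x k0 - b|))//.
apply/funext => x; rewrite (bigD1 k0)//= ltnn eqxx mulrC; congr (_ * _).
by apply: eq_bigr => k /negbTE ->.
Qed.

(** Coordinate by coordinate, the kernel is replaced by the indicator function of a
half-line, so [mu] and [nu] agree on orthants. *)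
Theorem potential_inj A : measurable A -> mu (A `&` K) = nu (A `&` K).
Proof.
pose G := [set O | exists a, O = orthant a].
apply: (@measure_unique _ _ _ G (fun n => orthant (fun=> - n%:R)) _ _ _ _
  (mrestr mu mK) (mrestr nu mK)).
- exact: orthant_generate.
- by move=> _ _ [a ->] [b ->]; rewrite orthantI; eexists.
- by move=> n; eexists.
- by rewrite (bigcup_orthant pred0 (fun=> 0)); apply/seteqP.
- move=> _ [a ->]; rewrite /= /mrestr.
  have [_ _] := same_integral_orthant a (leqnn N).
  rewrite (_ : (fun _ => _) = \1_(orthant a)); last first.
    apply/funext => x; rewrite indicE; have [ax|/existsNP[k /negP ax]] := pselect (orthant a x).
      by rewrite mem_set// big1// => k _; rewrite ltn_ord (ax k).
    rewrite memNset => [|/(_ k)]; last by rewrite (negbTE ax).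
    by rewrite (bigD1 k)//= ltn_ord (negbTE ax) mul0r.
  have mO := measurable_orthant a.
  have mOK : measurable (orthant a `&` K) by exact: measurableI.
  rewrite /Rintegral !integral_indic// => E.
  by rewrite -[LHS]fineK ?fin_num_measure// -[RHS]fineK ?fin_num_measure// E.
- move=> n; rewrite /= /mrestr ltey_eq fin_num_measure//.
  by apply: measurableI => //; exact: measurable_orthant.
Qed.

End orthant.

(** * Uniqueness of weight measures *)

Section weight_measure_theory.
Context (R : realType) (N : nat) (K : set (N.-tuple R)).
Hypotheses (mK : measurable K) (tbK : d1_totally_bounded K).
Implicit Types (omega : {charge set (N.-tuple R) -> \bar R}).
Implicit Types (mu nu : {finite_measure set (N.-tuple R) -> \bar R}).

Lemma charge_integral_potential omega mu nu a :
  (forall A, measurable A -> omega A = (fine (mu A) - fine (nu A))%:E) ->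
  charge_integral omega K (fun x => (expR (- d1 x a))%:E) =
  (potential mu K a - potential nu K a)%:E.
Proof.
move=> omE; apply: (@charge_integralE _ _ _ _ _ _ _ _ 1) => //.
- exact: measurable_expR_d1.
- by move=> x; exact: norm_expR_d1.
Qed.

Lemma weight_measure_restr omega mu nu A :
  (forall A, measurable A -> A `&` K = set0 -> omega A = 0%E) ->
  (forall A, measurable A -> omega A = (fine (mu A) - fine (nu A))%:E) ->
  measurable A -> omega A = (fine (mu (A `&` K)) - fine (nu (A `&` K)))%:E.
Proof.
move=> omK omE mA; rewrite -omE; last exact: measurableI.
have AK0 : (A `\` K) `&` K = set0 by rewrite setDE -setIA setICl setI0.
by rewrite (chargeDI omega mA mK) (omK _ (measurableD mA mK) AK0) add0e.
Qed.

Lemma potential_measure_add mu nu a :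
  potential (measure_add mu nu) K a = potential mu K a + potential nu K a.
Proof.
apply: (@Rintegral_measure_add _ _ _ _ _ _ _ 1) => //.
- exact: measurable_expR_d1.
- by move=> x; exact: norm_expR_d1.
Qed.

(** The difference of two weight measures has potential 0 on [K].  It is handled as
an equality of positive measures, each weight measure contributing its negative
part to the other side. *)
Theorem weight_measure_unique omega omega' :
  weight_measure K omega -> weight_measure K omega' ->
  forall A, measurable A -> omega' A = omega A.
Proof.
move=> [omK om1] [om'K om'1] A mA.
have [mu [nu omE]] := jordan_difference omega.
have [mu' [nu' om'E]] := jordan_difference omega'.
rewrite (weight_measure_restr omK omE mA) (weight_measure_restr om'K om'E mA).
have : measure_add mu' nu (A `&` K) = measure_add mu nu' (A `&` K).
  apply: potential_inj => //; apply: potential_eq0 => // a Ka.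
  rewrite !potential_measure_add.
  have := om1 a Ka; rewrite (charge_integral_potential _ omE) => -[e].
  have := om'1 a Ka; rewrite (charge_integral_potential _ om'E) => -[e'].
  lra.
have mAK : measurable (A `&` K) by exact: measurableI.
rewrite !measure_addE => /(congr1 fine); rewrite !fineD ?fin_num_measure// => e.
by congr (_%:E); lra.
Qed.

End weight_measure_theory.

(** * Unions of cubes *)

Section cube_theory.
Context (R : realType) (N : nat).
Implicit Types (p q a x : N.-tuple R) (r : R).

Lemma measurable_cube p r : measurable (cube p r).
Proof.
exact: (@measurable_box _ _ (fun k => [set` `[tnth p k - r, tnth p k + r]])).
Qed.

Lemma measurable_cubes (F : {fset N.-tuple R}) r : measurable (cubes F r).
Proof.
by apply: fin_bigcup_measurable => // p _; exact: measurable_cube.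
Qed.

(** A grid with [M] + 1 points along each edge of each cube. *)
Lemma cubes_totally_bounded (F : {fset N.-tuple R}) r : 0 < r ->
  d1_totally_bounded (cubes F r).
Proof.
move=> r0 delta d0.
pose M := (Num.truncn (2 * r * N%:R / delta)).+1.
pose I := (F * {ffun 'I_N -> 'I_M.+1})%type.
pose h := 2 * r / M%:R.
have M0 : 0 < M%:R :> R by rewrite ltr0n.
have h0 : 0 < h by rewrite divr_gt0// mulr_gt0.
have hM : h * M%:R = r + r by rewrite /h divfK ?gt_eqF//; ring.
pose pt (i : I) := [tuple tnth (val i.1) k - r + h * (i.2 k)%:R | k < N].
exists #|{: I}|, (fun i => pt (enum_val i)); split.
  move=> i; exists (val (enum_val i).1); first exact: valP.
  case: (enum_val i) => p j k; rewrite tnth_mktuple in_itv/=.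
  rewrite lerDl mulr_ge0 ?(ltW h0)//= -addrA lerD2l addrC lerBlDr -hM.
  by rewrite ler_wpM2l ?(ltW h0)// ler_nat -ltnS.
move=> x [p /= pF px].
have idx k : exists j : 'I_M.+1, `|tnth x k - (tnth p k - r + h * j%:R)| <= h.
  have := px k; rewrite in_itv/= => /andP[x1 x2].
  pose y := (tnth x k - (tnth p k - r)) / h.
  have y0 : 0 <= y by rewrite divr_ge0 ?(ltW h0)// subr_ge0.
  have yM : (Num.truncn y < M.+1)%N.
    rewrite ltnS -(ler_nat R) (@le_trans _ _ y) ?truncn_le//.
    by rewrite ler_pdivrMr// mulrC hM; lra.
  exists (Ordinal yM) => /=.
  have /andP[ty yt] := truncn_itv y0.
  have -> : tnth x k = tnth p k - r + h * y.
    by rewrite mulrC divfK ?gt_eqF//; ring.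
  rewrite opprD addrACA subrr add0r -mulrBr normrM gtr0_norm//.
  rewrite ler_piMr ?(ltW h0)// ger0_norm ?subr_ge0// lerBlDr nat1r.
  exact: ltW.
pose j := [ffun k => xchoose (idx k)].
exists (enum_rank (([` pF]%fset, j) : I)).
rewrite enum_rankK.
apply: (@le_trans _ _ (\sum_(k < N) h)).
  apply: ler_sum => k _; rewrite tnth_mktuple/= ffunE.
  exact: (xchooseP (idx k)).
rewrite sumr_const card_ord -mulr_natl /h mulrA ler_pdivrMr//.
rewrite mulrC [leRHS]mulrC -ler_pdivrMr//; apply/ltW; exact: truncnS_gt.
Qed.

(** The nearest point of the cube is obtained by clamping each coordinate. *)
Lemma d1_set_cube p r x : 0 <= r ->
  d1_set (cube p r) x = \sum_(k < N) dist_itv (tnth p k) r (tnth x k).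
Proof.
move=> r0.
pose c := [tuple Num.max (tnth p k - r) (Num.min (tnth p k + r) (tnth x k)) | k < N].
have cE k : `|tnth c k - tnth x k| = dist_itv (tnth p k) r (tnth x k).
  rewrite tnth_mktuple /dist_itv.
  set u := tnth p k; set v := tnth x k.
  have [uv|uv] := leP (u + r) v.
    rewrite [X in `|X - v|]max_r; last by lra.
    by rewrite !ler0_norm; [|lra..]; rewrite max_r; lra.
  have [vu|vu] := leP (u - r) v.
    rewrite subrr normr0 max_l//.
    by have [h|h] := leP v u; [rewrite ger0_norm|rewrite ltr0_norm]; lra.
  by rewrite !gtr0_norm; [|lra..]; rewrite max_r; lra.
have cC : cube p r c.
  move=> k; rewrite tnth_mktuple in_itv/= le_max lexx/= ge_max lerD2l ge_min lexx/=.
  by rewrite andbT ge0_cp.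
rewrite /d1_set; apply/eqP; rewrite eq_le; apply/andP; split.
  apply: (@le_trans _ _ (d1 c x)); last by apply: ler_sum => k _; rewrite cE.
  apply: ge_inf; last by exists c.
  by exists 0 => _ [b _ <-]; exact: d1_ge0.
apply: lb_le_inf; first by exists (d1 c x), c.
move=> _ [b bC <-]; apply: ler_sum => k _; rewrite /dist_itv.
have := bC k; rewrite in_itv/= => /andP[b1 b2].
rewrite ge_max normr_ge0/= lerBlDr.
have pb : `|tnth p k - tnth b k| <= r by rewrite ler_norml; apply/andP; split; lra.
have := ler_normD (tnth p k - tnth b k) (tnth b k - tnth x k).
rewrite addrA subrK; lra.
Qed.

End cube_theory.

Section sinh_interpolation.
Context (R : realType).
Implicit Types (c r y z : R).

(** The solutions of g'' = g on the interval, a space of dimension 2. *)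
Definition exp_span c r (g : R -> R) :=
  exists A B : R, forall y, y \in `[c - r, c + r] -> g y = A * expR y + B * expR (- y).

(** Lagrange basis of that space for the two endpoints: the quotient
sinh(r + s (y - c)) / sinh(2 r), with s the sign encoded by [b]. *)
Definition sinh_weight c r (b : bool) y : R :=
  (expR (r + sgb R b * (y - c)) - expR (- (r + sgb R b * (y - c)))) /
  (expR (2 * r) - expR (- (2 * r))).

Lemma sinh_interpolation c r g y : 0 < r -> exp_span c r g ->
  y \in `[c - r, c + r] ->
  g y = \sum_(b : bool) sinh_weight c r b y * g (c + r * sgb R b).
Proof.
move=> r0 [A [B gE]] yI.
have h2 : expR (2 * r) - expR (- (2 * r)) != 0.
  by rewrite subr_eq0 gt_eqF// ltr_expR; lra.
rewrite big_bool/= /sinh_weight /sgb expr1 expr0 !mulN1r !mul1r mulr1 mulrN1.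
rewrite (gE y yI) !gE ?in_itv/=; [|apply/andP; split; lra..].
have u0 : expR r != 0 by rewrite gt_eqF ?expR_gt0.
have v0 : expR c != 0 by rewrite gt_eqF ?expR_gt0.
have t0 : expR y != 0 by rewrite gt_eqF ?expR_gt0.
move: h2; rewrite (_ : 2 * r = r + r); last by ring.
rewrite !opprD !opprK !(expRD, expRN).
move=> h2; field; rewrite u0 v0 t0 /= andbT.
have uu : expR r * expR r - (expR r)^-1 / expR r =
  (expR r * expR r * (expR r * expR r) - 1) / (expR r * expR r) by field.
by move: h2; rewrite uu mulf_eq0 negb_or => /andP[].
Qed.

(** A point that is not interior to the interval does not see the kink of the
absolute value. *)
Lemma exp_span_dist c r z : z <= c - r \/ c + r <= z ->
  exp_span c r (fun y => expR (- `|z - y|)).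
Proof.
case=> zc.
  exists 0, (expR z) => y; rewrite in_itv/= => /andP[y1 y2].
  by rewrite mul0r add0r -expRD ler0_norm ?opprK//; lra.
exists (expR (- z)), 0 => y; rewrite in_itv/= => /andP[y1 y2].
by rewrite mul0r addr0 -expRD ger0_norm ?opprB 1?addrC//; lra.
Qed.

Lemma exp_span_dist_itv c r z : 0 <= r -> r *+ 2 < `|z - c| ->
  exp_span c r (fun y => expR (- dist_itv z r y)).
Proof.
move=> r0; have [zc|zc] := leP z c.
  rewrite ler0_norm ?subr_le0// mulr2n => h.
  exists 0, (expR (z + r)) => y; rewrite in_itv/= => /andP[y1 y2].
  rewrite mul0r add0r -expRD /dist_itv ler0_norm; last lra.
  by rewrite max_r; [congr expR; ring|lra].
rewrite gtr0_norm ?subr_gt0// mulr2n => h.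
exists (expR (- z + r)), 0 => y; rewrite in_itv/= => /andP[y1 y2].
rewrite mul0r addr0 -expRD /dist_itv ger0_norm; last lra.
by rewrite max_r; [congr expR; ring|lra].
Qed.

Lemma prod_sinh_interpolation N (q a : N.-tuple R) r (g : 'I_N -> R -> R) :
  0 < r -> (forall k, exp_span (tnth q k) r (g k)) -> cube q r a ->
  \prod_k g k (tnth a k) =
  \sum_(t : N.-tuple bool)
     (\prod_k sinh_weight (tnth q k) r (tnth t k) (tnth a k)) *
     \prod_k g k (tnth (vertex q r t) k).
Proof.
move=> r0 gq aq.
(* Expanding a product of sums of two terms gives one term for each vertex. *)
transitivity (\prod_k \sum_(b : bool) sinh_weight (tnth q k) r b (tnth a k) *
    g k (tnth q k + r * sgb R b)).
  by apply: eq_bigr => k _; apply: sinh_interpolation => //; exact: aq.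
rewrite bigA_distr_bigA/=.
rewrite (reindex (fun t : N.-tuple bool => [ffun k => tnth t k])); last first.
  exists (fun f : {ffun 'I_N -> bool} => [tuple f k | k < N]) => [t _|f _].
    by apply: eq_from_tnth => k; rewrite tnth_mktuple ffunE.
  by apply/ffunP => k; rewrite ffunE tnth_mktuple.
apply: eq_bigr => t _; rewrite -big_split/=; apply: eq_bigr => k _.
by rewrite ffunE tnth_mktuple.
Qed.

End sinh_interpolation.

(** * Faces, vertices and the linear system *)

Section side_potential.
Context (R : realType).
Implicit Types (c r a : R) (o : option bool).

Definition side_potential c r a o : R :=
  if o is Some b then expR (- `|c + r * sgb R b - a|)
  else \int[@lebesgue_measure R]_(x in [set` `[c - r, c + r]]) expR (- `|x - a|).

Definition side_length r o : R := if o is Some _ then 1 else 2 * r.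

Lemma side_potential_None c r a : 0 <= r ->
  (\int[@lebesgue_measure R]_(x in [set` `[c - r, c + r]%R])
    (expR (- `|x - a|)%R)%:E = (side_potential c r a None)%:E)%E.
Proof.
by move=> r0; have [I IE _] := integral_expR_dist_itv c a r0; rewrite /= /Rintegral IE.
Qed.

Lemma sum_option_bool (f : option bool -> R) :
  \sum_o f o = f None + f (Some false) + f (Some true).
Proof.
rewrite (bigD1 None)//= (bigD1 (Some false))//= (bigD1 (Some true))//= big1 ?addr0 ?addrA//.
by move=> [[]|].
Qed.

Lemma sum_side_potential c r a : 0 <= r ->
  \sum_o side_potential c r a o = 2 * expR (- dist_itv c r a).
Proof.
move=> r0; have [I IE <-] := integral_expR_dist_itv c a r0.
rewrite sum_option_bool /= /Rintegral IE /= /sgb expr0 expr1 mulr1 mulrN1.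
by rewrite -!addrA; congr (_ + _); rewrite addrC.
Qed.

Lemma sum_side_length r : \sum_o side_length r o = 2 * (1 + r).
Proof. by rewrite sum_option_bool /=; ring. Qed.

End side_potential.

(** Facts about one face relative to any [K] that contains the cube; the factors
for a fixed and for a free coordinate are gathered in functions of the code of
the face, so that summing over all faces is summing over the codes. *)
Lemma face_measure (R : realType) (N : nat) (p : N.-tuple R) (r : R)
    (c : {ffun 'I_N -> option bool}) : 0 < r ->
  exists nu : {finite_measure set (N.-tuple R) -> \bar R},
  forall K, measurable K -> cube p r `<=` K ->
  [/\ (nu : set (N.-tuple R) -> \bar R) = face_volume p r c,
      nu (~` K) = 0%E,
      forall a, potential nu K a =
        \prod_k side_potential (tnth p k) r (tnth a k) (c k) &
      fine (nu K) = \prod_(k < N) side_length r (c k)].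
Proof.
move=> r0; have [nu nuE int_nu] := face_volume_finite_measure p r c.
exists nu => K mK pK.
have nuK : nu (~` K) = 0%E.
  rewrite nuE /face_volume (_ : [set u | _] = set0).
    by have [mu <-] := lebesgue_tuple_sigma_finite R #|free_coord c|; rewrite measure0.
  apply/seteqP; split => // u /= [Fu]; apply; apply: pK => k; have := Fu k.
  case: (c k) => // b ->; rewrite in_itv/= /sgb.
  by case: b; rewrite ?expr1 ?expr0; lra.
have int_K (g : 'I_N -> R -> R) (G : 'I_N -> R) : (forall k, measurable_fun setT (g k)) -> (forall k x, 0 <= g k x) ->
    (forall k, if c k is Some b then g k (tnth p k + r * sgb R b) = G k
     else (\int[@lebesgue_measure R]_(x in [set` `[(tnth p k - r)%R, (tnth p k + r)%R]])
             (g k x)%:E = (G k)%:E)%E) ->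
    \int[nu]_(x in K) (\prod_k g k (tnth x k)) = \prod_k G k.
  move=> mg g0 gG; rewrite /Rintegral -(@ge0_integral_concentrated _ _ _ nu)//.
  - by rewrite (int_nu g G).
  - by apply/measurable_EFinP; exact: measurable_prod_tnth.
  - by move=> x; rewrite lee_fin prodr_ge0.
split => //.
- move=> a; rewrite /potential; under eq_Rintegral do rewrite expR_d1.
  apply: (int_K (fun k y => expR (- `|y - tnth a k|))) => [k|k x|k].
  + do 2! apply: measurableT_comp => //; apply: measurableT_comp => //.
    exact: measurable_funB.
  + exact: expR_ge0.
  + case: (c k) => [//|]; exact/side_potential_None/ltW.
- rewrite -(int_K (fun _ _ => 1)) => [|//|//|k].
    under eq_Rintegral do rewrite big1//.
    by rewrite Rintegral_cst// mul1r.
  case: (c k) => [//|]; rewrite integral_cst// mul1e.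
  rewrite -[LHS]/(@lebesgue_measure R _) lebesgue_measure_itv/= lte_fin.
  by rewrite ltrD2l gtrN// -EFinB; congr (_%:E); ring.
Qed.

Lemma vertex_cube (R : realType) (N : nat) (p : N.-tuple R) (r : R) s :
  0 <= r -> cube p r (vertex p r s).
Proof.
move=> r0 k; rewrite tnth_mktuple in_itv/= /sgb.
by case: (tnth s k); rewrite ?expr1 ?expr0 ?mulr1 ?mulrN1; apply/andP; split; lra.
Qed.

Section skew.
Context (R : realType) (N : nat) (F : {fset N.-tuple R}) (r : R).
Hypotheses (r_gt0 : 0 < r) (r_lt : (r%:E < skewness [set` F] / 2%:E)%E).

Lemma skew_gap p q k : p \in F -> q \in F -> p != q ->
  r *+ 2 < `|tnth p k - tnth q k|.
Proof.
move=> pF qF pq; move: r_lt; rewrite inver pnatr_eq0/= lte_pdivlMr// => /lt_le_trans h.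
rewrite -lte_fin -mulr_natr EFinM.
by apply: h; apply: ereal_inf_lbound; exists p, q, k.
Qed.

(** Two vertices of distinct cubes differ because their centres differ by more
than 2 [r] in each coordinate. *)
Lemma vertex_inj : injective (fun i : F * N.-tuple bool => vertex (val i.1) r i.2).
Proof.
have r0 := r_gt0; have gap := skew_gap.
move=> [p s] [q t] /= pq.
have E k : tnth (val p) k + r * sgb R (tnth s k) = tnth (val q) k + r * sgb R (tnth t k).
  by have /(congr1 (fun x => tnth x k)) := pq; rewrite !tnth_mktuple.
have {}pq : p = q.
  apply/val_inj/eq_from_tnth => k.
  apply/eqP; apply: contraT => pqk.
  have npq : val p != val q by apply: contraNN pqk => /eqP ->.
  have := gap _ _ k (valP p) (valP q) npq; have := E k; rewrite /sgb mulr2n.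
  have [|] := leP 0 (tnth (val p) k - tnth (val q) k) => ?.
    by rewrite ger0_norm//; case: (tnth s k); case: (tnth t k); rewrite ?expr1 ?expr0; lra.
  by rewrite ltr0_norm//; case: (tnth s k); case: (tnth t k); rewrite ?expr1 ?expr0; lra.
rewrite pq; congr pair; apply: eq_from_tnth => k; have := E k.
rewrite pq => /addrI; rewrite /sgb.
by case: (tnth s k); case: (tnth t k); rewrite ?expr1 ?expr0 //; lra.
Qed.

Lemma coeff_system_exists : exists2 alpha : F -> N.-tuple bool -> R,
  coeff_system r alpha & forall beta, coeff_system r beta -> beta = alpha.
Proof.
have [w wE wu] := d1_system_unique vertex_inj (fun j : F * N.-tuple bool =>
  \sum_(p : F | p != j.1) expR (- d1_set (cube (val p) r) (vertex (val j.1) r j.2))).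
exists (fun p s => w (p, s)).
  by move=> q t; rewrite -(wE (q, t)) pair_big; apply: eq_bigr => -[].
move=> beta bE; apply/funext => p; apply/funext => s.
rewrite -[RHS](congr1 (fun f => f (p, s)) (wu (fun i => beta i.1 i.2) _))//.
by move=> [q t]; rewrite -[RHS](bE q t) pair_big; apply: eq_bigr => -[].
Qed.

(** On the cube of [q], both sides are sums of products of functions in the
two-dimensional spaces [exp_span] attached to the coordinates, hence are
interpolated from the vertices by the same formula, and the system says that
they agree there. *)
Lemma coeff_system_cube alpha (q : F) a : coeff_system r alpha ->
  cube (val q) r a ->
  \sum_(p : F) \sum_(s : N.-tuple bool)
     alpha p s * expR (- d1 (vertex (val p) r s) a) =
  \sum_(p : F | p != q) expR (- d1_set (cube (val p) r) a).
Proof.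
move=> aE aq.
have gap (p : F) k : p != q -> r *+ 2 < `|tnth (val p) k - tnth (val q) k|.
  by move=> pq; apply: skew_gap => //; exact: valP.
have r0 := r_gt0.
pose L (t : N.-tuple bool) :=
  \prod_k sinh_weight (tnth (val q) k) r (tnth t k) (tnth a k).
have left (p : F) s : expR (- d1 (vertex (val p) r s) a) =
    \sum_t L t * expR (- d1 (vertex (val p) r s) (vertex (val q) r t)).
  rewrite expR_d1; under [RHS]eq_bigr do rewrite expR_d1.
  apply: (@prod_sinh_interpolation _ _ (val q) a r
    (fun k y => expR (- `|tnth (vertex (val p) r s) k - y|))) => // k.
  apply: exp_span_dist; rewrite tnth_mktuple /sgb.
  have [->|pq] := eqVneq p q.
    by case: (tnth s k); rewrite ?expr1 ?expr0; [left|right]; lra.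
  have := gap p k pq; rewrite mulr2n.
  have [?|?] := leP 0 (tnth (val p) k - tnth (val q) k).
    by rewrite ger0_norm// => ?; right; case: (tnth s k); rewrite ?expr1 ?expr0; lra.
  by rewrite ltr0_norm// => ?; left; case: (tnth s k); rewrite ?expr1 ?expr0; lra.
have right (p : F) : p != q -> expR (- d1_set (cube (val p) r) a) =
    \sum_t L t * expR (- d1_set (cube (val p) r) (vertex (val q) r t)).
  move=> pq; rewrite d1_set_cube ?ltW// -sumrN expR_sum.
  under [RHS]eq_bigr do rewrite d1_set_cube ?ltW// -sumrN expR_sum.
  apply: (@prod_sinh_interpolation _ _ (val q) a r
    (fun k y => expR (- dist_itv (tnth (val p) k) r y))) => // k.
  by apply: exp_span_dist_itv; rewrite ?ltW// gap.
transitivity (\sum_t L t * \sum_(p : F) \sum_(s : N.-tuple bool)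
     alpha p s * expR (- d1 (vertex (val p) r s) (vertex (val q) r t))).
  under eq_bigr => p _.
    under eq_bigr do rewrite left mulr_sumr.
    rewrite exchange_big /=.
  over.
  rewrite exchange_big/=; apply: eq_bigr => t _; rewrite mulr_sumr.
  apply: eq_bigr => p _; rewrite mulr_sumr; apply: eq_bigr => s _.
  by rewrite mulrCA.
under eq_bigr do rewrite aE mulr_sumr.
by rewrite exchange_big/=; apply: eq_bigr => p pq; rewrite right.
Qed.

End skew.

(** * The weight measure of a union of cubes *)

Lemma lebesgue_skeleton_sum (R : realType) (N : nat) (F : {fset N.-tuple R})
    (r : R) (A : set (N.-tuple R)) (v : F -> {ffun 'I_N -> option bool} -> R) :
  (forall p c, face_volume (val p) r c A = (v p c)%:E) ->
  (\sum_(D < N.+1) lebesgue_skeleton F r D A)%E = (\sum_p \sum_c v p c)%:E.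
Proof.
move=> vE; transitivity (\sum_(D < N.+1)
    \sum_p \sum_(c | #|free_coord c| == D) v p c)%:E; last first.
  congr (_%:E); rewrite exchange_big; apply: eq_bigr => p _ /=.
  have cN (c : {ffun 'I_N -> option bool}) : (#|free_coord c| < N.+1)%N.
    by rewrite ltnS -[leqRHS]card_ord max_card.
  by rewrite [RHS](partition_big (fun c => Ordinal (cN c)) predT)//=.
rewrite -sumEFin; apply: eq_bigr => D _; rewrite /lebesgue_skeleton -sumEFin.
by apply: eq_bigr => p _; rewrite -sumEFin; apply: eq_bigr => c _; rewrite vE.
Qed.

Theorem theorem5p1 (R : realType) (N : nat) (F : {fset N.-tuple R})
    (F_neq0 : F != fset0) (F_skew : (0 < skewness [set` F])%E)
    (r : R) (r_gt0 : 0 < r) (r_lt : (r%:E < skewness [set` F] / 2%:E)%E) :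
  exists (omega : {charge set (N.-tuple R) -> \bar R})
         (alpha : F -> N.-tuple bool -> R),
    [/\ weight_measure (cubes F r) omega /\
        (forall omega' : {charge set (N.-tuple R) -> \bar R},
           weight_measure (cubes F r) omega' ->
           forall A, measurable A -> omega' A = omega A),
        coeff_system r alpha /\
        (forall beta, coeff_system r beta -> beta = alpha),
        forall A, measurable A ->
          omega A =
            ((2 ^- N)%:E * (\sum_(D < N.+1) lebesgue_skeleton F r D A)
             - \sum_(p : F) \sum_(s : N.-tuple bool)
                 (alpha p s)%:E * \d_(vertex (val p) r s) A)%E
      & mag (cubes F r) =
          (#|` F|%:R * (1 + r) ^+ N
           - \sum_(p : F) \sum_(s : N.-tuple bool) alpha p s)%:E].
Proof.
have r0 : 0 <= r by exact: ltW.
have [alpha aE au] := coeff_system_exists r_gt0 r_lt.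
set K := cubes F r.
have mK : measurable K by exact: measurable_cubes.
have tbK : d1_totally_bounded K by exact: cubes_totally_bounded.
have cubeK (p : F) : cube (val p) r `<=` K by move=> x px; exists (val p) => //; exact: valP.
have vK (p : F) s : K (vertex (val p) r s).
  by apply: (cubeK p); exact: vertex_cube.
have [face faceP] := choice (fun z : F * {ffun 'I_N -> option bool} =>
  face_measure (val z.1) z.2 r_gt0).
pose I := (F * {ffun 'I_N -> option bool} + F * N.-tuple bool)%type.
pose c (i : I) : R := match i with inl _ => 2 ^- N | inr z => - alpha z.1 z.2 end.
pose m (i : I) : {finite_measure set (N.-tuple R) -> \bar R} :=
  match i with
  | inl z => face z
  | inr z => @dirac _ (N.-tuple R) (vertex (val z.1) r z.2) R
  end.
have diracm p s A : m (inr (p, s)) A = (vertex (val p) r s \in A)%:R%:E.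
  by rewrite -diracE.
have [mu [nu [massE intE]]] := signed_combination (index_enum I) c m.
have sumI (f : I -> R) : \sum_i f i = \sum_p \sum_g f (inl (p, g)) + \sum_p \sum_s f (inr (p, s)).
  by rewrite big_sumType/= !pair_big; congr (_ + _); apply: eq_bigr => -[].
have two0 : 2 ^+ N != 0 :> R by rewrite expf_neq0// pnatr_eq0.
(* Summing over all the faces factors as a product over the coordinates of sums
     over the three codes: free, upper end, lower end. *)
have face_pot (p : F) a : \sum_g potential (face (p, g)) K a =
    2 ^+ N * expR (- d1_set (cube (val p) r) a).
  rewrite d1_set_cube// -sumrN expR_sum -[in 2 ^+ N](card_ord N) -prodr_const -big_split/=.
  under [RHS]eq_bigr do rewrite -sum_side_potential//.
  rewrite bigA_distr_bigA/=; apply: eq_bigr => g _.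
  by have [_ _ -> _] := faceP (p, g) K mK (cubeK p).
have potE a : K a -> potential mu K a - potential nu K a = 1.
  move=> Ka; have [q0 qF aq] := Ka.
  pose q : F := [` qF]%fset.
  rewrite /potential (@intE K _ 1)//; last 2 first.
  - exact: measurable_expR_d1.
  - by move=> x; rewrite expR_ge0 expR_d1_le1.
  rewrite sumI /c /m.
  have -> : \sum_p \sum_s - alpha p s * \int[@dirac _ (N.-tuple R) (vertex (val p) r s) R]_(x in K) expR (- d1 x a)
     = - \sum_(p : F | p != q) expR (- d1_set (cube (val p) r) a).
    rewrite -(coeff_system_cube r_gt0 r_lt aE (q := q) aq) -sumrN.
    apply: eq_bigr => p _; rewrite -sumrN; apply: eq_bigr => s _.
    rewrite mulNr /Rintegral integral_dirac//.
      by rewrite diracE mem_set// mul1e.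
    by apply/measurable_EFinP; apply: measurable_funTS; exact: measurable_expR_d1.
  rewrite [X in X - _](_ : _ = \sum_(p : F) expR (- d1_set (cube (val p) r) a)); last first.
    apply: eq_bigr => p _; rewrite -mulr_sumr.
    by rewrite [X in _ * X](face_pot p a) mulrA mulVf// mul1r.
  rewrite (bigD1 q)//= addrK d1_set_cube// big1 ?oppr0 ?expR0// => k _.
  rewrite /dist_itv max_l//.
  by have := aq k; rewrite in_itv/= => /andP[a1 a2]; rewrite subr_le0 ler_norml; lra.
have [omega omegaE] := charge_of_difference mu nu.
have omegaW : weight_measure K omega.
  split; last first.
    move=> a Ka; rewrite (charge_integral_potential mK a omegaE) potE//.
  move=> A mA AK; rewrite omegaE// massE// big1// => i _.
  case: i => [[p g]|[p s]]; last first.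
    rewrite diracm memNset ?mulr0// => Av.
    by change ((set0 : set (N.-tuple R)) (vertex (val p) r s)); rewrite -AK.
  have [fE f0 _ _] := faceP (p, g) K mK (cubeK p).
  rewrite (_ : m _ A = 0%E) ?mulr0//.
  apply/eqP; rewrite eq_le measure_ge0 andbT -f0 le_measure ?inE//.
    exact: measurableC.
  by move=> x Ax Kx; change ((set0 : set (N.-tuple R)) x); rewrite -AK.
exists omega, alpha; split => //.
- by split => // omega' omega'W; exact: (weight_measure_unique mK tbK omegaW omega'W).
- move=> A mA; rewrite omegaE// massE// sumI.
  rewrite (@lebesgue_skeleton_sum _ _ _ _ _ (fun p g => fine (face (p, g) A))); last first.
    move=> p g; have [fE _ _ _] := faceP (p, g) K mK (cubeK p).
    by rewrite -fE fineK// fin_num_measure.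
  rewrite EFinD -EFinM; congr (_ + _)%E.
    congr (_%:E); rewrite mulr_sumr; apply: eq_bigr => p _.
    by rewrite mulr_sumr.
  rewrite -[LHS]oppeK; congr (- _)%E; rewrite -EFinN -sumrN -sumEFin.
  apply: eq_bigr => p _; rewrite -sumrN -sumEFin; apply: eq_bigr => s _.
  by rewrite diracm mulNr opprK diracE.
- rewrite (mag_weight mK tbK potE); congr (_%:E); rewrite massE// sumI; congr (_ + _).
    transitivity (\sum_(p : F) (1 + r) ^+ N).
      apply: eq_bigr => p _; rewrite -mulr_sumr.
      transitivity (2 ^- N * \prod_(k < N) \sum_o side_length r o).
        rewrite bigA_distr_bigA/=; congr (_ * _); apply: eq_bigr => g _.
        by have [_ _ _ ->] := faceP (p, g) K mK (cubeK p).
      by rewrite sum_side_length prodr_const card_ord exprMn mulrA mulVf// mul1r.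
    by rewrite sumr_const cardfE mulr_natl.
  rewrite -sumrN; apply: eq_bigr => p _; rewrite -sumrN; apply: eq_bigr => s _.
  by rewrite diracm mem_set ?mulr1//; exact: vK.
Qed.
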